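(* Let $N\ge2$, let $\mu_1<\cdots<\mu_K<0$ be the distinct spectral values with multiplicities $k_1,\dots,k_K\ge1$, $k_1+\cdots+k_K=N$, and let $I_\alpha$, $\nu_1,\dots,\nu_N$ and $\mathcal{M}_{\mathrm{multi}}$ be as defined in the context. Assume $u=(u_1,\dots,u_N)\in H^1(\mathbb{R})^N$ is a solution of $$u_i''+2\Big(\sum_{j=1}^Nu_j^2\Big)u_i+\nu_iu_i=0\quad\text{in }\mathbb{R},\qquad i=1,\dots,N.$$ If $\sum_{i\in I_\alpha}u_i^2\not\equiv0$ holds for every $\alpha=1,\dots,K$, then $u\in\mathcal{M}_{\mathrm{multi}}$.
   Context: All functions are real-valued; equations for $H^1$ functions are understood in the distributional sense and $H^1$ solutions are identified with their $C^2$ representatives. Blocks and repeated parameters: $N_0:=0$, $N_\alpha:=k_1+\cdots+k_\alpha$, $I_\alpha:=\{N_{\alpha-1}+1,\dots,N_\alpha\}$ for $\alpha=1,\dots,K$, and $\nu_i:=\mu_\alpha$ for $i\in I_\alpha$. Put $\eta_\alpha=\sqrt{-\mu_\alpha}>0$. Reduced determinant family: for $a=(a_1,\dots,a_K)\in(\mathbb{R}\setminus\{0\})^K$ let $V^a=(V_1^a,\dots,V_K^a)$ with $$V_\alpha^a(x)=\frac{a_\alpha e^{\eta_\alpha x}\det(I+B^{(\alpha)}M(x))}{\det(I+M(x))},$$ where $I$ is the $K\times K$ identity matrix, $M(x)=(m_{\beta\gamma}(x))_{1\le\beta,\gamma\le K}$ with $m_{\beta\gamma}(x)=\frac{a_\beta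 a_\gamma}{2\sqrt{\eta_\beta\eta_\gamma}(\eta_\beta+\eta_\gamma)}e^{(\eta_\beta+\eta_\gamma)x}$, and $B^{(\alpha)}=\operatorname{diag}\big(\frac{\eta_\alpha-\eta_1}{\eta_\alpha+\eta_1},\dots,\frac{\eta_\alpha-\eta_K}{\eta_\alpha+\eta_K}\big)$. Extended family: for $a\in(\mathbb{R}\setminus\{0\})^K$ and unit vectors $n^{(\alpha)}=(n^{(\alpha)}_i)_{i\in I_\alpha}\in\mathbb{S}^{k_\alpha-1}\subset\mathbb{R}^{k_\alpha}$ (i.e. $\sum_{i\in I_\alpha}(n_i^{(\alpha)})^2=1$), $\alpha=1,\dots,K$, define $U^{a,n}=(U_1^{a,n},\dots,U_N^{a,n})$ by $U_i^{a,n}(x)=n_i^{(\alpha)}V_\alpha^a(x)$ for $i\in I_\alpha$, $\alpha=1,\dots,K$. Then $$\mathcal{M}_{\mathrm{multi}}:=\{U^{a,n}:\ a\in(\mathbb{R}\setminus\{0\})^K,\ n^{(\alpha)}\in\mathbb{S}^{k_\alpha-1},\ \alpha=1,\dots,K\}.$$ *)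

(* Defs.v *)
From HB Require Import structures.
From mathcomp Require Import all_boot all_order all_algebra.
From mathcomp Require Import all_classical all_reals all_analysis.

Set Implicit Arguments.
Unset Strict Implicit.
Unset Printing Implicit Defensive.

Import Order.TTheory GRing.Theory Num.Theory.
Import numFieldNormedType.Exports.

Local Open Scope classical_set_scope.
Local Open Scope ring_scope.

Definition test_function (R : realType) (phi : R -> R) : Prop :=
  (forall (n : nat) (x : R), derivable (phi^`(n)%classic) x 1) /\
  compact (closure [set x | phi x != 0]).

Definition weak_derivative (R : realType) (f g : R -> R) : Prop :=
  forall phi : R -> R, test_function phi ->
    \int[lebesgue_measure]_x (f x * phi^`()%classic x) =
    - \int[lebesgue_measure]_x (g x * phi x).

Definition H1 (R : realType) (f : R -> R) : Prop :=
  f \in Lfun (@lebesgue_measure R) 2%:E /\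
  exists2 g : R -> R,
    g \in Lfun (@lebesgue_measure R) 2%:E & weak_derivative f g.

(* The system u_i'' + 2 (sum_j u_j^2) u_i + nu_i u_i = 0 in D'(R).  It is only
   meaningful when the cubic term is locally integrable (Rintegral has a junk
   value otherwise); this is automatic when all the u_j are in H1, hence
   essentially bounded. *)
Definition distributional_solution (R : realType) (N : nat) (nu : 'I_N -> R)
    (u : 'I_N -> R -> R) : Prop :=
  forall (i : 'I_N) (phi : R -> R), test_function phi ->
    \int[lebesgue_measure]_x
      (u i x * phi^`(2)%classic x
       + (2 * (\sum_(j < N) u j x ^+ 2) * u i x + nu i * u i x) * phi x) = 0.

(* Indices are 0-based: the a-th block consists of the i with
   k_0 + ... + k_(a-1) <= i < k_0 + ... + k_a. *)
Definition block_start (K : nat) (k : 'I_K -> nat) (a : 'I_K) : nat :=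
  (\sum_(b < K | (b < a)%N) k b)%N.

Definition in_block (K : nat) (k : 'I_K -> nat) (a : 'I_K) (i : nat) : bool :=
  (block_start k a <= i < block_start k a + k a)%N.

Section DeterminantFamily.
Variables (R : realType) (K : nat) (mu : 'I_K -> R).

Definition eta (b : 'I_K) : R := Num.sqrt (- mu b).

Definition Mmx (a : 'I_K -> R) (x : R) : 'M[R]_K :=
  \matrix_(b < K, c < K)
    (a b * a c / (2 * Num.sqrt (eta b * eta c) * (eta b + eta c))
     * expR ((eta b + eta c) * x)).

Definition Bmx (b : 'I_K) : 'M[R]_K :=
  diag_mx (\row_(c < K) ((eta b - eta c) / (eta b + eta c))).

Definition Vfun (a : 'I_K -> R) (b : 'I_K) (x : R) : R :=
  a b * expR (eta b * x) * \det (1%:M + Bmx b *m Mmx a x)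
  / \det (1%:M + Mmx a x).

(* [n b i] is the i-th entry of the unit vector n^(b), whose index set is the
   b-th block; its values for i outside that block are irrelevant. *)
Definition Mmulti (N : nat) (k : 'I_K -> nat) : set ('I_N -> R -> R) :=
  [set U | exists (a : 'I_K -> R) (n : 'I_K -> 'I_N -> R),
    [/\ forall b, a b != 0,
        forall b, \sum_(i < N | in_block k b i) n b i ^+ 2 = 1
      & forall (b : 'I_K) (i : 'I_N), in_block k b i ->
          forall x, U i x = n b i * Vfun a b x]].

End DeterminantFamily.

(* Main.v *)
(** Testing the weak equations with smoothed trapezoids and letting them tend to
    indicator functions of intervals with Lebesgue points as end points shows
    that [u] has a C^2 representative [U] solving the system pointwise.

    Put [H = diag(eta_i)], [psi_i = U_i / sqrt(2 eta_i)] and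
    [P = 1 - \int_{-oo}^x psi psi^T]. The defects
    [r = psi' + H psi - 2 P H psi] and [Q = P H + H P - 2 P H P - psi psi^T]
    satisfy the linear system [r' = (H - 2 P H) r + 2 Q H psi],
    [Q' = - r psi^T - psi r^T], and tend to 0 along a sequence going to -oo;
    since [H - 2 P H] tends to [- H] at -oo, a Gronwall argument gives
    [r = 0] and [Q = 0]. Hence [psi] and the columns of [P e^{xH}] solve the same
    linear equation [y' = (2 P H - H) y], so that [psi = P v] with [v = e^{xH} c]
    for a constant vector [c]. With the Cauchy matrix
    [A = (v_i v_j / (eta_i + eta_j))], for which [A' = v v^T], the matrix
    [Z = (1 + A) P - 1] satisfies [Z' = - Z v psi^T] and vanishes at -oo, hence
    everywhere, and [(1 + A) psi = v]. Grouping equal [eta_i] reduces this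
    system to one unknown per block, and the matrix determinant lemma turns its
    solution into the quotient of determinants. *)

Require Import Defs.
From HB Require Import structures.
From mathcomp Require Import all_boot all_order all_algebra.
From mathcomp Require Import all_classical all_reals all_analysis.
From mathcomp Require Import measurable_realfun.
From mathcomp Require Import ring lra.

Set Implicit Arguments.
Unset Strict Implicit.
Unset Printing Implicit Defensive.

Import Order.TTheory GRing.Theory Num.Theory.
Import numFieldNormedType.Exports.

Local Open Scope classical_set_scope.
Local Open Scope ring_scope.


(** * Weak derivatives on the line *)

Section SmoothStep.
Variable R : realType.
Implicit Types (f g : R -> R) (p : {poly R}) (x y : R).

Lemma expn_le_fact_expR n y : 0 <= y -> y ^+ n <= n`!%:R * expR y.
Proof.
move=> y0; case: n => [|n].
  by rewrite expr0 fact0 mul1r; apply: le_trans (expR_ge1Dx _); rewrite lerDl.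
have := expR_ge1Dxn n y0.
have f0 : 0 < (n.+1)`!%:R :> R by rewrite ltr0n fact_gt0.
move=> h; rewrite mulrC -ler_pdivrMr//; apply: le_trans h.
by rewrite lerDr.
Qed.

Lemma horner_le_expR p :
  exists2 C : R, 0 <= C & forall y, 0 <= y -> `|p.[y]| <= C * expR y.
Proof.
exists (\sum_(i < size p) `|p`_i| * i`!%:R).
  by apply: sumr_ge0 => i _; rewrite mulr_ge0.
move=> y y0; rewrite horner_coef mulr_suml.
apply: le_trans (ler_norm_sum _ _ _) _; apply: ler_sum => i _.
rewrite normrM normrX (ger0_norm y0) -mulrA.
by apply: ler_wpM2l => //; exact: expn_le_fact_expR.
Qed.

(** The bound at h = 0 forces f(0) = 0, and then the difference quotient at 0 is at most C |h|. *)
Lemma is_derive0_quadratic f (C : R) : (forall h, `|f h| <= C * h ^+ 2) ->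
  is_derive (0 : R) (1 : R) f 0.
Proof.
move=> fC; have f0 : f 0 = 0.
  by have := fC 0; rewrite expr0n/= mulr0 normr_le0 => /eqP.
have C0 : 0 <= C.
  by have := fC 1; rewrite expr1n mulr1; apply: le_trans; rewrite normr_ge0.
have cv : h^-1 *: (f (h *: 1 + 0) - f 0) @[h --> (0 : R)^'] --> (0 : R).
  apply/cvgrPdist_le => /= e e0; near=> h.
  have h0 : h != 0 by near: h; exact: nbhs_dnbhs_neq.
  rewrite sub0r normrN f0 subr0 addr0 /GRing.scale/= mulr1 normrM normfV.
  rewrite mulrC ler_pdivrMr ?normr_gt0//; apply: le_trans (fC h) _.
  rewrite -real_normK ?num_real// expr2 mulrA ler_wpM2r//.
  have : `|h| <= e / (C + 1).
    near: h; apply: dnbhs0_le; rewrite divr_gt0// ltr_wpDl//.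
  rewrite ler_pdivlMr ?ltr_wpDl// mulrC; apply: le_trans.
  by apply: ler_wpM2r => //; rewrite lerDl.
apply: DeriveDef; first by apply/cvg_ex; exists 0.
by apply: cvg_lim => //; exact: Rhausdorff.
Unshelve. all: by end_near. Qed.

(** The polynomial parameter makes this family of functions, flat at 0, closed under
    differentiation. *)
Definition flat p x := if 0 < x then p.[x^-1] * expR (- x^-1) else 0.

Lemma is_derive_flat p x :
  is_derive x (1 : R) (flat p) (flat ('X^2 * (p - p^`())) x).
Proof.
rewrite {2}/flat; case: (ltrgt0P x) => [x0|x0|->].
- have inv_d : is_derive x (1 : R) (fun y => y^-1) (- x ^- 2).
    have := @is_deriveV R id x 1 1; rewrite gt_eqF//= /GRing.scale/= mulr1.
    by apply => //; exact: is_derive_id.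
  apply: (@near_eq_is_derive _ _ _ (fun y => p.[y^-1] * expR (- y^-1))).
    near=> y; rewrite /flat ifT//; near: y; exact: lt_nbhsr.
  have h1 := @is_derive1_comp _ (horner p) (fun y => y^-1) x _ _ (is_derive_poly p _) inv_d.
  have h2 := @is_derive1_comp _ expR (fun y => - y^-1) x _ _ (is_derive_expR _) (is_deriveN inv_d).
  have h3 := is_deriveM h1 h2.
  apply: (is_derive_eq h3).
  rewrite /= /GRing.scale/= !hornerE/=.
  by field; rewrite gt_eqF.
- have nf : \near x, (cst 0 : R -> R) x = flat p x.
    near=> y; rewrite /flat ifF//; apply/negbTE; rewrite -leNgt ltW//.
    by near: y; exact: lt_nbhsl.
  exact: near_eq_is_derive nf (is_derive_cst _ _ _).
(* With y = 1/h, the bound |p(y) y^2| <= C e^y says that |[flat p h]| <= C h^2. *)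
- have [C C0 hC] := horner_le_expR (p * 'X^2).
  apply: (@is_derive0_quadratic _ C) => h; rewrite /flat; case: ifPn => h0; last first.
    by rewrite normr0 mulr_ge0 ?sqr_ge0.
  have hi : 0 <= h^-1 by rewrite invr_ge0 ltW.
  have := hC _ hi; rewrite hornerM hornerXn !normrM expRN.
  rewrite (ger0_norm hi) (@ger0_norm _ (_^-1)) ?invr_ge0 ?expR_ge0// => hh.
  rewrite ler_pdivrMr ?expR_gt0// mulrAC -ler_pdivrMr ?exprn_gt0//.
  by rewrite expr2 invfM.
Unshelve. all: by end_near. Qed.

Lemma flat_ge0 x : 0 <= flat 1 x.
Proof. by rewrite /flat; case: ifP => // _; rewrite hornerE mul1r expR_ge0. Qed.

Lemma flat_gt0 x : 0 < x -> 0 < flat 1 x.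
Proof. by move=> x0; rewrite /flat x0 hornerE mul1r expR_gt0. Qed.

(** A syntactic class that contains the derivatives of its members; smoothness of every cut-off
    below is read off from membership. *)
Inductive elem_smooth : (R -> R) -> Prop :=
| elem_cst c : elem_smooth (fun=> c)
| elem_flat p : elem_smooth (flat p)
| elem_aff f a b : elem_smooth f -> elem_smooth (fun x => f (a * x + b))
| elem_add f g : elem_smooth f -> elem_smooth g ->
    elem_smooth (fun x => f x + g x)
| elem_mul f g : elem_smooth f -> elem_smooth g ->
    elem_smooth (fun x => f x * g x)
| elem_inv f : (forall x, f x != 0) -> elem_smooth f ->
    elem_smooth (fun x => (f x)^-1).

Lemma is_derive_mull (a x : R) : is_derive x (1 : R) (fun y => a * y) a.
Proof.
apply: is_derive_eq (is_deriveZ a (is_derive_id x (1 : R))) _.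
by rewrite /GRing.scale/= mulr1.
Qed.

Lemma is_derive_affine (a b x : R) : is_derive x (1 : R) (fun y => a * y + b) a.
Proof.
apply: is_derive_eq (is_deriveD (is_derive_mull a x) (is_derive_cst b x (1 : R))) _.
exact: addr0.
Qed.

Lemma elem_smooth_derive f : elem_smooth f ->
  exists2 g, elem_smooth g & forall x, is_derive x (1 : R) f (g x).
Proof.
elim=> {f} [c|p|f a b sf [g sg fg]|f1 f2 sf1 [g1 sg1 d1] sf2 [g2 sg2 d2]
           |f1 f2 sf1 [g1 sg1 d1] sf2 [g2 sg2 d2]|f f0 sf [g sg fg]].
- by exists (fun=> 0); [exact: elem_cst|move=> x; exact: is_derive_cst].
- by exists (flat ('X^2 * (p - p^`()))); [exact: elem_flat|exact: is_derive_flat].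
- exists (fun x => g (a * x + b) * a).
    by apply: elem_mul; [exact: elem_aff|exact: elem_cst].
  by move=> x; exact: (is_derive1_comp (fg _) (is_derive_affine a b x)).
- exists (fun x => g1 x + g2 x); first exact: elem_add.
  by move=> x; exact: is_deriveD.
- exists (fun x => f1 x * g2 x + f2 x * g1 x).
    by apply: elem_add; exact: elem_mul.
  by move=> x; exact: is_deriveM.
- exists (fun x => (- 1) * ((f x)^-1 * (f x)^-1) * g x).
    apply: elem_mul => //; apply: elem_mul; first exact: elem_cst.
    by apply: elem_mul; exact: elem_inv.
  move=> x; apply: is_derive_eq (is_deriveV (f0 x) (fg x)) _.
  by rewrite /GRing.scale/= expr2 invfM mulN1r.
Qed.

Lemma elem_smooth_derivable f n x : elem_smooth f ->
  derivable (f^`(n))%classic x (1 : R).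
Proof.
elim: n f x => [|n ih] f x /elem_smooth_derive[g sg fg].
  by have := fg x; case.
rewrite derive1Sn (_ : f^`()%classic = g); first exact: ih.
by apply/funext => y; rewrite derive1E; apply: derive_val.
Qed.

Lemma elem_smooth_continuous f : elem_smooth f -> continuous f.
Proof.
move=> sf x; apply/differentiable_continuous/derivable1_diffP.
exact: (@elem_smooth_derivable f 0 x).
Qed.

(** The standard smooth transition from 0 to 1 across [0, 1]. The affine argument is spelled so as
    to match [elem_aff]. *)
Definition step x := flat 1 x * (flat 1 x + flat 1 (- 1 * x + 1))^-1.

Lemma step_den_gt0 x : 0 < flat 1 x + flat 1 (- 1 * x + 1).
Proof.
have [x0|x0] := ltP 0 x.
  by rewrite ltr_pwDl ?flat_gt0 ?flat_ge0.
by rewrite ltr_wpDl ?flat_ge0// flat_gt0//; lra.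
Qed.

Lemma elem_smooth_step : elem_smooth step.
Proof.
apply: elem_mul; first exact: elem_flat.
apply: elem_inv => [x|]; first by rewrite gt_eqF// step_den_gt0.
by apply: elem_add; [exact: elem_flat|apply: elem_aff; exact: elem_flat].
Qed.

Lemma step_le0 x : x <= 0 -> step x = 0.
Proof. by move=> x0; rewrite /step {1}/flat ltNge x0 mul0r. Qed.

Lemma step_ge1 x : 1 <= x -> step x = 1.
Proof.
move=> x1; rewrite /step.
have -> : flat 1 (- 1 * x + 1) = 0 by rewrite /flat ifF//; apply/negbTE; rewrite -leNgt; lra.
rewrite addr0 divff// gt_eqF// flat_gt0//; lra.
Qed.

Lemma step_ge0_le1 x : 0 <= step x <= 1.
Proof.
rewrite /step divr_ge0 ?flat_ge0//=; last exact: ltW (step_den_gt0 x).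
by rewrite ler_pdivrMr ?step_den_gt0// mul1r lerDl flat_ge0.
Qed.

End SmoothStep.

(** * Recovering point values at Lebesgue points *)

Section WeakDerivative.
Variable R : realType.
Notation mu := (@lebesgue_measure R).
Implicit Types (f g : R -> R) (s t x y : R).

Lemma locally_integrable_itv f a b : locally_integrable setT f ->
  mu.-integrable `[a, b] (EFin \o f).
Proof.
move=> [mf _ intf]; apply/integrableP; split.
  by apply/measurable_EFinP; apply: measurable_funS mf.
by apply: intf => //; exact: segment_compact.
Qed.

Lemma continuous_locally_integrable f : continuous f -> locally_integrable setT f.
Proof.
move=> cf; split; [exact: continuous_measurable_fun|exact: openT|].
move=> K _ cK; have := continuous_compact_integrable cK (continuous_subspaceT cf).
by case/integrableP.
Qed.

Lemma integrable_itvM f (h : R -> R) (a b C : R) : mu.-integrable `[a, b] (EFin \o f) ->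
  measurable_fun `[a, b] h -> (forall x, `|h x| <= C) ->
  mu.-integrable `[a, b] (EFin \o (fun x => f x * h x)).
Proof.
move=> intf mh hC.
have mf : measurable_fun `[a, b] f by apply/measurable_EFinP; case/integrableP: intf.
have C0 : 0 <= C by apply: le_trans (hC 0).
apply: (@le_integrable _ _ _ mu _ _ _ (fun x => C%:E * (f x)%:E)%E) => //.
- by apply/measurable_EFinP; exact: measurable_funM.
- move=> x _ /=; rewrite lee_fin !normrM mulrC (ger0_norm C0).
  by rewrite ler_wpM2r.
- exact: integrableZl.
Qed.

Definition dstep : R -> R := (@step R)^`()%classic.

Lemma is_derive_step x : is_derive x 1 (@step R) (dstep x).
Proof.
have [g _ dg] := elem_smooth_derive (@elem_smooth_step R).
by rewrite /dstep derive1E; apply: DeriveDef => //; case: (dg x).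
Qed.

Lemma elem_smooth_dstep : elem_smooth dstep.
Proof.
have [g sg dg] := elem_smooth_derive (@elem_smooth_step R).
rewrite (_ : dstep = g)//; apply/funext => x.
by rewrite /dstep derive1E; apply: derive_val.
Qed.

Lemma dstep_out x : (x < 0) || (1 < x) -> dstep x = 0.
Proof.
move=> xo; rewrite /dstep derive1E.
case/orP: xo => x01.
  rewrite (@near_eq_derive _ _ _ _ (cst (0 : R))) ?derive_cst//.
  near=> y; rewrite /cst step_le0// ltW//; near: y; exact: lt_nbhsl.
rewrite (@near_eq_derive _ _ _ _ (cst (1 : R))) ?derive_cst//.
near=> y; rewrite /cst step_ge1// ltW//; near: y; exact: lt_nbhsr.
Unshelve. all: by end_near. Qed.

Lemma dstep_bounded : exists C, forall x, `|dstep x| <= C.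
Proof.
have cd : continuous (fun x => `|dstep x|).
  move=> x; apply: continuous_comp; last exact: norm_continuous.
  exact: (elem_smooth_continuous elem_smooth_dstep).
have [c _ hc] := EVT_max ler01 (continuous_subspaceT cd).
exists `|dstep c| => x; have [x0|x0] := ltP x 0.
  by rewrite dstep_out ?x0// normr0.
have [x1|x1] := ltP 1 x; first by rewrite dstep_out ?x1 ?orbT// normr0.
by apply: hc; rewrite in_itv/= x0 x1.
Qed.

(** The transition rescaled to rise between s and s + 1/c, its argument c (x - s) being put in the
    form of [elem_aff]. For large c its derivative [dramp] approximates a Dirac mass at s. *)
Definition ramp (c s x : R) : R := step (c * x + - (c * s)).

Lemma elem_smooth_ramp c s : elem_smooth (ramp c s).
Proof. exact: elem_aff (@elem_smooth_step R). Qed.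

Definition dramp (c s x : R) : R := dstep (c * x + - (c * s)) * c.

Lemma is_derive_ramp c s x : is_derive x 1 (ramp c s) (dramp c s x).
Proof. exact: (is_derive1_comp (is_derive_step _) (is_derive_affine _ _ x)). Qed.

Lemma continuous_dramp c s : continuous (dramp c s).
Proof.
apply: elem_smooth_continuous; apply: elem_mul; last exact: elem_cst.
exact: elem_aff elem_smooth_dstep.
Qed.

Lemma ramp_le c s x : 0 < c -> x <= s -> ramp c s x = 0.
Proof. by move=> c0 xs; rewrite /ramp step_le0// -mulrBr pmulr_rle0// subr_le0. Qed.

Lemma ramp_ge c s x : 0 < c -> s + c^-1 <= x -> ramp c s x = 1.
Proof.
move=> c0 xs; rewrite /ramp step_ge1// -mulrBr mulrC -ler_pdivrMr// mul1r.
by rewrite lerBrDl.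
Qed.

Lemma dramp_out c s x : 0 < c -> x \notin `[s, s + c^-1] -> dramp c s x = 0.
Proof.
move=> c0; rewrite in_itv/= negb_and -!ltNge => xo.
rewrite /dramp dstep_out ?mul0r// -mulrBr.
rewrite pmulr_rlt0// subr_lt0; case/orP: xo => [->//|h].
by rewrite orbC mulrC -ltr_pdivrMr// mul1r ltrBrDl h.
Qed.

Lemma Rintegral_out f D : (forall x, ~ D x -> f x = 0) ->
  \int[mu]_x f x = \int[mu]_(x in D) f x.
Proof.
move=> fD; rewrite [RHS]Rintegral_mkcond; apply: eq_Rintegral => x _.
by rewrite patchE; case: ifPn => // /negP; rewrite inE; exact: fD.
Qed.

Lemma Rintegral_dramp c s : 0 < c ->
  \int[mu]_(x in `[s, s + c^-1]) dramp c s x = 1.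
Proof.
move=> c0; rewrite /Rintegral.
have ssc : s < s + c^-1 by rewrite ltrDl invr_gt0.
rewrite (@continuous_FTC2 _ _ (ramp c s))//.
- by rewrite /= ramp_ge// ramp_le// subr0.
- exact: continuous_subspaceT (@continuous_dramp c s).
- have cr := elem_smooth_continuous (elem_smooth_ramp c s).
  split.
  + by move=> x _; case: (is_derive_ramp c s x).
  + exact/cvg_at_right_filter/cr.
  + exact/cvg_at_left_filter/cr.
- by move=> x _; rewrite derive1E; case: (is_derive_ramp c s x).
Qed.

(** Since [dramp] has integral 1, the error is the integral of (f - f(s)) [dramp]. The kernel is of
    size C c on an interval of length 1/c, so the error is controlled by a mean of |f - f(s)| near
    s. *)
Lemma lebesgue_pt_dramp f s : locally_integrable setT f -> lebesgue_pt f s ->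
  \int[mu]_x (f x * dramp n.+1%:R s x) @[n --> \oo] --> f s.
Proof.
move=> lf fs.
have [C hC] := dstep_bounded.
have C0 : 0 <= C by apply: le_trans (hC 0).
(* The closed interval [s, s + 1/c] lies in the open ball of radius 2/c, whose measure is 4/c;
   multiplied by the bound C c of the kernel, this gives 4 C. *)
have bound n : `|\int[mu]_x (f x * dramp n.+1%:R s x) - f s| <=
    C * 4 * fine (davg f s (2 / n.+1%:R)).
  set c : R := n.+1%:R.
  have c0 : 0 < c by rewrite ltr0n.
  set J := `[s, s + c^-1]%classic : set R.
  rewrite (@Rintegral_out _ J); last first.
    move=> x Jx; rewrite dramp_out ?mulr0//.
    by apply/negP => xJ; exact: Jx.
  have mJ : measurable (J : set (measurableTypeR R)) by exact: measurable_itv.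
  have md : measurable_fun J (dramp c s).
    apply: measurable_funS (measurableT) _ _ => //.
    exact: continuous_measurable_fun (@continuous_dramp c s).
  have bd x : `|dramp c s x| <= C * c.
    by rewrite normrM (ger0_norm (ltW c0)) ler_wpM2r// ltW.
  have if1 : mu.-integrable J (EFin \o (fun x => f x * dramp c s x)).
    by apply: integrable_itvM bd => //; exact: locally_integrable_itv.
  have i1 : mu.-integrable J (EFin \o (cst 1 : R -> R)).
    apply: continuous_compact_integrable; first exact: segment_compact.
    exact/continuous_subspaceT/cst_continuous.
  have id : mu.-integrable J (EFin \o dramp c s).
    apply: continuous_compact_integrable; first exact: segment_compact.
    exact/continuous_subspaceT/continuous_dramp.
  have fE : f s = \int[mu]_(x in J) (f s * dramp c s x).
    by rewrite RintegralZl// Rintegral_dramp// mulr1.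
  rewrite [X in _ - X]fE.
  have if2 : mu.-integrable J (EFin \o (fun x => f s * dramp c s x)).
    by have := integrableZl mJ (f s) id.
  rewrite -RintegralB//.
  have lfc : locally_integrable setT (fun x => f x - f s).
    apply: locally_integrableB => //; apply: continuous_locally_integrable.
    exact: cst_continuous.
  have if3 : mu.-integrable J
      (EFin \o (fun x => f x * dramp c s x - f s * dramp c s x)).
    by have := integrableB mJ if1 if2.
  have ifc a b : mu.-integrable `[a, b] (EFin \o (fun x => `|f x - f s|)).
    by apply: integrable_norm; exact: (locally_integrable_itv _ _ lfc).
  apply: le_trans (le_normr_Rintegral mJ if3) _.
  apply: (@le_trans _ _ (\int[mu]_(x in J) (C * c * `|f x - f s|))).
    apply: le_Rintegral => //.
    - exact: integrable_norm if3.
    - by have := integrableZl mJ (C * c) (ifc s (s + c^-1)).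
    - by move=> x _; rewrite -mulrBl normrM mulrC ler_wpM2r.
  rewrite (RintegralZl _ mJ (ifc _ _)).
  have d0 : 0 < 2 / c by rewrite divr_gt0.
  set I := \int[mu]_(x in J) `|f x - f s|.
  suff h : I <= 4 / c * fine (davg f s (2 / c)).
    apply: (le_trans (ler_wpM2l _ h)); first by rewrite mulr_ge0// ltW.
    by rewrite le_eqVlt; apply/orP; left; apply/eqP; field; rewrite gt_eqF.
  have JB : J `<=` ball s (2 / c).
    move=> x; rewrite /J /= in_itv/= => /andP[sx xs]; rewrite /ball/=.
    rewrite distrC ger0_norm ?subr_ge0// ltrBlDl; apply: le_lt_trans xs _.
    by rewrite ltrD2l ltr_pdivlMr// mulVf ?gt_eqF// ltr1n.
  have BK : ball s (2 / c) `<=` `[s - 2 / c, s + 2 / c].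
    by rewrite ball_itv; apply: subset_itvW.
  have mB : measurable (ball s (2 / c) : set (measurableTypeR R)).
    exact: measurable_ball.
  have ib : mu.-integrable (ball s (2 / c)) (EFin \o (fun x => `|f x - f s|)).
    apply: (integrableS _ mB BK (ifc _ _)); exact: measurable_itv.
  have fJ := integrable_fin_num mJ (ifc s (s + c^-1)).
  have fB := integrable_fin_num mB ib.
  apply: (@le_trans _ _ (\int[mu]_(x in ball s (2 / c)) `|f x - f s|)).
    rewrite /I /Rintegral fine_le//.
    apply: ge0_subset_integral => //.
    by case/integrableP : ib.
  rewrite /davg /iavg /= lebesgue_measure_ball ?(ltW d0)//.
  rewrite inver ifF; last by apply/negbTE; rewrite mulrn_eq0/= gt_eqF.
  rewrite fineM//=.
  rewrite mulrA (_ : 4 / c * (2 / c *+ 2)^-1 = 1) ?mul1r//.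
  by field; rewrite gt_eqF.
have dav : fine (davg f s (2 / n.+1%:R)) @[n --> \oo] --> (0 : R).
  have /cvg_at_rightP h : fine (davg f s r) @[r --> 0^'+] --> (0 : R).
    exact: fine_cvg.
  apply: (h (fun n => 2 / n.+1%:R)); split; first by move=> n; rewrite divr_gt0.
  rewrite -[X in _ --> X](mulr0 2); apply: cvgM; first exact: cvg_cst.
  exact: cvg_harmonic.
apply/cvgrPdist_le => e e0.
have : C * 4 * fine (davg f s (2 / n.+1%:R)) @[n --> \oo] --> (0 : R).
  by rewrite -[X in _ --> X](mulr0 (C * 4)); apply: cvgM => //; exact: cvg_cst.
move=> /cvgrPdist_le h; near=> n.
rewrite distrC; apply: le_trans (bound n) _; have : `|0 - C * 4 * fine (davg f s (2 / n.+1%:R))| <= e.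
  by near: n; exact: h.
by rewrite sub0r normrN; apply: le_trans; exact: ler_norm.
Unshelve. all: by end_near. Qed.

End WeakDerivative.

(** * Increments of weakly differentiable functions *)

Section WeakIncrement.
Variable R : realType.
Notation mu := (@lebesgue_measure R).
Implicit Types (f g : R -> R) (s t x y : R).

Definition trapezoid (c s t x : R) : R := ramp c s x + - 1 * ramp c t x.

Lemma elem_smooth_trapezoid c s t : elem_smooth (trapezoid c s t).
Proof.
apply: elem_add; first exact: elem_smooth_ramp.
by apply: elem_mul; [exact: elem_cst|exact: elem_smooth_ramp].
Qed.

Lemma trapezoid_out c s t x : 0 < c -> s <= t ->
  x \notin `[s, t + c^-1] -> trapezoid c s t x = 0.
Proof.
move=> c0 st; rewrite in_itv/= negb_and -!ltNge /trapezoid => /orP[xs|tx].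
  by rewrite !ramp_le ?mulr0 ?addr0// ltW// (lt_le_trans xs).
rewrite !ramp_ge ?(ltW tx)//; first by rewrite mulN1r subrr.
by apply: le_trans (ltW tx); rewrite lerD2r.
Qed.

Lemma test_function_trapezoid c s t : 0 < c -> s <= t ->
  test_function (trapezoid c s t).
Proof.
move=> c0 st; split.
  by move=> n x; exact: elem_smooth_derivable (elem_smooth_trapezoid c s t).
apply: (@subclosed_compact _ _ `[s, t + c^-1]%classic).
- exact: closed_closure.
- exact: segment_compact.
- rewrite closureE; apply: smallest_sub; first exact: itv_closed.
  move=> x /= /eqP h; apply: contrapT => /negP xo; apply: h.
  exact: trapezoid_out.
Qed.

Lemma trapezoid_norm_le1 c s t x : `|trapezoid c s t x| <= 1.
Proof.
have := step_ge0_le1 (c * x + - (c * s)); have := step_ge0_le1 (c * x + - (c * t)).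
rewrite /trapezoid /ramp => /andP[a1 a2] /andP[b1 b2].
by rewrite ler_norml; apply/andP; split; lra.
Qed.

Lemma derive1_trapezoid c s t :
  (trapezoid c s t)^`()%classic = fun x => dramp c s x - dramp c t x.
Proof.
apply/funext => x; rewrite derive1E.
have h1 := is_derive_ramp c s x; have h2 := is_derive_ramp c t x.
have h3 := is_deriveD h1 (is_deriveZ (- 1) h2).
have -> : trapezoid c s t = ramp c s + (-1) \*: ramp c t by [].
by case: h3 => _ ->; rewrite /GRing.scale/= mulN1r.
Qed.

(** Each ramp vanishes at its starting point, which is why the limiting interval excludes s and
    includes t. *)
Lemma cvg_trapezoid s t x : s <= t ->
  trapezoid n.+1%:R s t x @[n --> \oo] --> (\1_(`]s, t]%classic) x : R).
Proof.
have rampc u : ramp n.+1%:R u x @[n --> \oo] --> ((u < x)%R%:R : R).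
  have [ux|xu] := ltP u x; last first.
    rewrite [X in X @ _ --> _](_ : _ = cst (0 : R)); first exact: cvg_cst.
    by apply/funext => n; rewrite ramp_le.
  apply: cvg_near_cst; near=> n; apply/eqP; rewrite ramp_ge//.
  rewrite -lerBrDl invf_ple ?posrE ?subr_gt0//.
  apply: (@le_trans _ _ n%:R); last by rewrite ler_nat.
  near: n; exact: nbhs_infty_ger.
move=> st; rewrite (_ : \1__ x = (s < x)%R%:R - (t < x)%R%:R); last first.
  rewrite indicE mem_setE in_itv/=.
  have [sx|xs] := ltP s x; rewrite (leNgt x t).
    by case: ltP => _; rewrite ?subrr ?subr0.
  by rewrite ltNge (le_trans xs st) subr0.
rewrite [X in X @ _ --> _](_ : _ =
  (fun n => ramp n.+1%:R s x - ramp n.+1%:R t x)); first exact: cvgB.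
by apply/funext => n; rewrite /trapezoid mulN1r.
Unshelve. all: by end_near. Qed.

(** Trapezoids are the test functions. The side with f converges to f(s) - f(t) because s and t are
    Lebesgue points, the side with g by dominated convergence. *)
Lemma weak_derivative_increment f g s t :
  locally_integrable setT f -> locally_integrable setT g ->
  weak_derivative f g -> lebesgue_pt f s -> lebesgue_pt f t -> s < t ->
  f t - f s = \int[mu]_(x in `]s, t]) g x.
Proof.
move=> lf lg fg fs ft st.
(* As 1/(n+1) <= 1, this interval contains the supports of all the trapezoids. *)
set D := `[s, t + 1]%classic : set R.
have mD : measurable (D : set (measurableTypeR R)) by exact: measurable_itv.
have c0 n : 0 < n.+1%:R :> R by rewrite ltr0n.
have ci n : (n.+1%:R : R)^-1 <= 1 by rewrite invf_le1// ler1n.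
have lhs n : \int[mu]_x (f x * (trapezoid n.+1%:R s t)^`()%classic x) =
    \int[mu]_x (f x * dramp n.+1%:R s x) - \int[mu]_x (f x * dramp n.+1%:R t x).
  have dout u x : s <= u -> u <= t -> ~ D x -> f x * dramp n.+1%:R u x = 0.
    move=> su ut Dx; rewrite dramp_out ?mulr0//; apply/negP => h; apply: Dx.
    move: h; rewrite /D /= !in_itv/= => /andP[h1 h2]; rewrite (le_trans su)//=.
    by apply: le_trans h2 _; exact: lerD.
  have di u : mu.-integrable D (EFin \o (fun x => f x * dramp n.+1%:R u x)).
    have [C hC] := dstep_bounded R.
    apply: (@integrable_itvM _ _ _ _ _ (C * n.+1%:R)).
    - exact: locally_integrable_itv.
    - apply: measurable_funS (measurableT) _ _ => //.
      exact: continuous_measurable_fun (@continuous_dramp _ _ _).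
    - by move=> x; rewrite normrM (ger0_norm (ltW (c0 n))) ler_wpM2r// ltW.
  rewrite (@Rintegral_out _ (fun x => f x * dramp _ s x) D); last first.
    by move=> x; apply: dout => //; exact: ltW.
  rewrite (@Rintegral_out _ (fun x => f x * dramp _ t x) D); last first.
    by move=> x; apply: dout => //; exact: ltW.
  rewrite derive1_trapezoid (@Rintegral_out _ _ D); last first.
    by move=> x Dx; rewrite mulrBr !dout ?subr0// ltW.
  rewrite -RintegralB//; apply: eq_Rintegral => x _; exact: mulrBr.
have l1 : (\int[mu]_x (f x * dramp n.+1%:R s x) -
    \int[mu]_x (f x * dramp n.+1%:R t x)) @[n --> \oo] --> f s - f t.
  exact: cvgB (lebesgue_pt_dramp lf fs) (lebesgue_pt_dramp lf ft).
have l2 : (- \int[mu]_x (g x * trapezoid n.+1%:R s t x)) @[n --> \oo] --> f s - f t.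
  rewrite [X in X @ _ --> _](_ : _ = (fun n => \int[mu]_x
    (f x * dramp n.+1%:R s x) - \int[mu]_x (f x * dramp n.+1%:R t x))); first exact: l1.
  apply/funext => n; rewrite -lhs fg//.
  by apply: test_function_trapezoid => //; exact: ltW.
have gi : mu.-integrable D (EFin \o g) by exact: locally_integrable_itv.
have mg : measurable_fun D g by apply/measurable_EFinP; case/integrableP: gi.
have mind : measurable_fun D (fun x => g x * \1_(`]s, t]%classic) x).
  by apply: measurable_funM => //; apply: measurable_funS (measurableT) _ _ => //; exact: measurable_indic.
have mtr n : measurable_fun D (fun x => g x * trapezoid n.+1%:R s t x).
  apply: measurable_funM => //; apply: measurable_funS (measurableT) _ _ => //.
  apply: continuous_measurable_fun; apply: elem_smooth_continuous.
  exact: elem_smooth_trapezoid.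
have [|||||ig _ cv] := @dominated_convergence _ _ _ mu D mD
  (fun n x => (g x * trapezoid n.+1%:R s t x)%:E)
  (fun x => (g x * \1_(`]s, t]%classic) x)%:E) (fun x => `|g x|%:E).
- by move=> n; apply/measurable_EFinP; exact: mtr.
- exact/measurable_EFinP.
- apply: aeW => x _; apply: cvg_EFin; first exact: nearW.
  by apply: cvgM; [exact: cvg_cst|exact: cvg_trapezoid (ltW st)].
- exact: integrable_norm gi.
- apply: aeW => x n _.
  by rewrite lee_fin normrM -[leRHS]mulr1 ler_wpM2l//; exact: trapezoid_norm_le1.
have cvR : \int[mu]_(x in D) (g x * trapezoid n.+1%:R s t x) @[n --> \oo] -->
    \int[mu]_(x in D) (g x * \1_(`]s, t]%classic) x).
  apply: fine_cvg; rewrite /Rintegral fineK//.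
  exact: integrable_fin_num ig.
have {}l2 : (- \int[mu]_(x in D) (g x * trapezoid n.+1%:R s t x))
    @[n --> \oo] --> f s - f t.
  rewrite [X in X @ _ --> _](_ : _ = (fun n =>
    - \int[mu]_x (g x * trapezoid n.+1%:R s t x))); first exact: l2.
  apply/funext => n; rewrite [in RHS](@Rintegral_out _ _ D)// => x Dx.
  rewrite trapezoid_out ?mulr0//; first exact: ltW.
  apply/negP => h; apply: Dx; move: h; rewrite /D /= !in_itv/= => /andP[-> h2].
  by apply: le_trans h2 _; rewrite lerD2l.
have e1 : f s - f t = _ := cvg_unique (@Rhausdorff R) l2 (cvgN cvR).
apply: oppr_inj; rewrite opprB e1; congr (- _).
rewrite (_ : `]s, t]%classic = D `&` `]s, t]%classic); last first.
  apply/seteqP; split => x; rewrite /D /= !in_itv/=; last by case.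
  by move=> /andP[h1 h2]; rewrite (ltW h1) h1 h2 (le_trans h2)// lerDl.
rewrite Rintegral_mkcondr; apply: eq_Rintegral => x xD.
rewrite patchE indicE; have : x \in D `&` `]s, t]%classic = (x \in `]s, t]%classic).
  by rewrite in_setI xD.
by move=> ->; case: ifP; rewrite ?mulr1 ?mulr0.
Qed.

End WeakIncrement.

(** * Primitives of locally integrable functions *)

Section Primitive.
Variable R : realType.
Notation mu := (@lebesgue_measure R).
Implicit Types (f g h : R -> R) (s t x y : R).

Lemma Rintegral_itv_cat g x y z : locally_integrable setT g ->
  x <= y -> y <= z ->
  \int[mu]_(t in `]x, z]) g t =
  \int[mu]_(t in `]x, y]) g t + \int[mu]_(t in `]y, z]) g t.
Proof.
move=> lg xy yz.
have mI : measurable (`]x, z]%classic : set (measurableTypeR R)) by exact: measurable_itv.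
have ig : mu.-integrable `]x, z] (EFin \o g).
  apply: (integrableS _ mI _ (locally_integrable_itv x z lg)).
    exact: measurable_itv.
  exact: subset_itv_oc_cc.
have := @Rintegral_itvB _ g (BRight x) (BRight z) y ig.
by rewrite !bnd_simp => /(_ xy yz) <-; rewrite addrC subrK.
Qed.

(** The oriented integral from 0 to x: at least one of the two intervals is empty. *)
Definition prim g x := \int[mu]_(t in `]0, x]) g t - \int[mu]_(t in `]x, 0]) g t.

Lemma prim_increment g x y : locally_integrable setT g -> x <= y ->
  prim g y - prim g x = \int[mu]_(t in `]x, y]) g t.
Proof.
move=> lg xy; rewrite /prim.
have emp a b : b <= a -> \int[mu]_(t in `]a, b]) g t = 0.
  by move=> ba; rewrite set_itv_ge ?Rintegral_set0// bnd_simp -leNgt.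
have [x0|x0] := leP 0 x.
  rewrite (emp _ _ x0) (emp y 0) ?(le_trans x0)// !subr0.
  by rewrite (@Rintegral_itv_cat _ 0 x y)// addrAC subrr add0r.
have [y0|y0] := leP 0 y.
  rewrite (emp y 0)// (emp 0 x) ?(ltW x0)// subr0 sub0r opprK.
  by rewrite (Rintegral_itv_cat lg (ltW x0) y0) addrC.
rewrite (emp 0 x) ?(ltW x0)// (emp 0 y) ?(ltW y0)// !sub0r opprK.
by rewrite (Rintegral_itv_cat lg xy (ltW y0)) addrC addrK.
Qed.

(** Otherwise the exceptional null set would be the whole line, although [0, 1] has measure 1. *)
Lemma ae_setT_ex (P : R -> Prop) : {ae mu, forall x, P x} -> exists x, P x.
Proof.
case=> N [mN N0 PN]; apply: contrapT => /forallNP nP.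
have NT : N = setT by apply/seteqP; split => // x _; apply: PN => /=; exact: nP.
have : (mu `[0%R, 1%R]%classic <= mu N)%E.
  by apply: le_measure; rewrite ?inE ?NT//; exact: measurable_itv.
by rewrite N0 lebesgue_measure_itv/= lte_fin ltr01 sube0 lee_fin ler10.
Qed.

(** One Lebesgue point s serves as base point; comparing it with any other Lebesgue point gives the
    formula there, and almost every point is one. *)
Lemma weak_derivative_prim f g :
  locally_integrable setT f -> locally_integrable setT g -> weak_derivative f g ->
  exists c, {ae mu, forall x, f x = c + prim g x}.
Proof.
move=> lf lg fg; have lp := lebesgue_differentiation lf.
have [s fs] := ae_setT_ex lp; exists (f s - prim g s).
have F := ae_filter_ringOfSetsType mu.
apply: filterS lp => t ft; apply/eqP; rewrite -subr_eq; apply/eqP.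
have [st|ts|->//] := ltgtP s t.
- have := weak_derivative_increment lf lg fg fs ft st.
  rewrite -prim_increment//; last exact: ltW.
  by move=> h; lra.
- have := weak_derivative_increment lf lg fg ft fs ts.
  rewrite -prim_increment//; last exact: ltW.
  by move=> h; lra.
Qed.

(** Locally, [prim] differs by a constant from an integral with fixed lower end point; continuity
    and the fundamental theorem carry over from the latter. *)
Lemma near_prim g a x : locally_integrable setT g -> a < x ->
  \forall y \near x, prim g a + \int[mu]_(t in `[a, y]) g t = prim g y.
Proof.
move=> lg ax; near=> y.
rewrite -Rintegral_itv_obnd_cbnd; last first.
  have mI : measurable (`]a, y]%classic : set (measurableTypeR R)) by exact: measurable_itv.
  apply: (integrableS _ mI _ (locally_integrable_itv a y lg)).
    exact: measurable_itv.
  exact: subset_itv_oc_cc.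
rewrite -prim_increment//; first by rewrite addrC subrK.
by apply: ltW; near: y; exact: lt_nbhsr.
Unshelve. all: by end_near. Qed.

Lemma continuous_prim g : locally_integrable setT g -> continuous (prim g).
Proof.
move=> lg x.
have xab : x - 1 < x + 1 by lra.
have h := parameterized_integral_continuous (ltW xab)
  (locally_integrable_itv _ _ lg).
have xI : x \in `]x - 1, x + 1[ by rewrite in_itv/=; apply/andP; split; lra.
have h1 := within_continuous_continuous xab h xI.
have ax : x - 1 < x by lra.
have np := near_prim lg ax.
rewrite /continuous_at -(nbhs_singleton np).
apply: cvg_trans; last exact: cvgD (cvg_cst (prim g (x - 1))) h1.
exact: near_eq_cvg.
Qed.

Lemma ae_eq_Rintegral f h (D : set (measurableTypeR R)) : measurable D ->
  measurable_fun setT f -> measurable_fun setT h ->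
  {ae mu, forall x, f x = h x} ->
  \int[mu]_(x in D) f x = \int[mu]_(x in D) h x.
Proof.
move=> mD mf mh fh; rewrite /Rintegral; congr fine; apply: ae_eq_integral => //.
- by apply/measurable_EFinP; apply: measurable_funS mf.
- by apply/measurable_EFinP; apply: measurable_funS mh.
- have F := ae_filter_ringOfSetsType mu.
  by apply: filterS fh => x -> _.
Qed.

(** A primitive depends only on the almost everywhere class of g, so g may be replaced by h before
    applying the fundamental theorem of calculus. *)
Lemma is_derive_prim g h x : locally_integrable setT g ->
  {ae mu, forall x, g x = h x} -> continuous h -> is_derive x 1 (prim g) (h x).
Proof.
move=> lg gh ch.
have lh := continuous_locally_integrable ch.
have [mg _ _] := lg; have [mh _ _] := lh.
have -> : prim g = prim h.
  apply/funext => y; rewrite /prim; congr (_ - _);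
    by apply: ae_eq_Rintegral => //; exact: measurable_itv.
have ax : x - 1 < x by lra.
have xb : x < x + 1 by lra.
have [d1 d2] := continuous_FTC1_closed xb (locally_integrable_itv _ _ lh) ax (ch x).
apply: near_eq_is_derive (near_prim lh ax) _.
rewrite -[h x]add0r; apply: is_deriveD; apply: DeriveDef => //.
by rewrite -derive1E.
Qed.

Lemma continuous_primitive f : continuous f ->
  exists F, forall x, is_derive x 1 F (f x).
Proof.
move=> cf; exists (prim f) => x; apply: is_derive_prim => //.
  exact: continuous_locally_integrable.
by apply: aeW.
Qed.

Lemma Lfun2_measurable f : f \in Lfun mu 2%:E -> measurable_fun setT f.
Proof. by move/sub_Lfun_mfun; rewrite inE. Qed.

(** On a compact set, |f| <= 1 + f^2 is an integrable bound. *)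
Lemma Lfun2_locally_integrable f : f \in Lfun mu 2%:E -> locally_integrable setT f.
Proof.
move=> f2; have mf := Lfun2_measurable f2.
split => //; first exact: openT.
move=> K KT cK.
have mK : measurable (K : set (measurableTypeR R)) by exact: compact_measurable.
have i1 : mu.-integrable K (EFin \o (cst 1 : R -> R)).
  exact: continuous_compact_integrable (continuous_subspaceT (@cst_continuous _ _ _)).
have i2 : mu.-integrable K (EFin \o (fun x => f x ^+ 2)).
  by apply: integrableS (Lfun2_integrable_sqr f2).
have i3 : mu.-integrable K (EFin \o (fun x => 1 + f x ^+ 2)).
  by have := integrableD mK i1 i2.
have : mu.-integrable K (EFin \o f).
  apply: (le_integrable mK) i3.
    by apply/measurable_EFinP; apply: measurable_funS mf.
  move=> x _ /=; rewrite lee_fin (@ger0_norm _ (1 + _)) ?addr_ge0 ?sqr_ge0//.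
  rewrite -(real_normK (num_real (f x))); set a := `|f x|.
  have a0 : 0 <= a by rewrite /a normr_ge0.
  by have := sqr_ge0 (a - 1); rewrite sqrrB; nra.
by case/integrableP.
Qed.

(** The integral of f^2 over the line bounds the one over each interval. This is how square
    integrability is passed on to the part on differential equations. *)
Lemma Lfun2_prim_sqr_bounded f h : f \in Lfun mu 2%:E -> continuous h ->
  {ae mu, forall x, f x = h x} ->
  exists C, forall x, `|prim (fun x => h x ^+ 2) x| <= C.
Proof.
move=> f2 ch fh; have mf := Lfun2_measurable f2.
have ch2 : continuous (fun x => h x ^+ 2).
  by move=> x; exact: (continuousM (ch x) (ch x)).
have mh2 := continuous_measurable_fun ch2.
have i2 := Lfun2_integrable_sqr f2.
have mf2 : measurable_fun setT (fun x => f x ^+ 2) by exact: measurable_funX.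
set C := \int[mu]_x (f x ^+ 2).
have bd x y : 0 <= \int[mu]_(t in `]x, y]) (h t ^+ 2) <= C.
  rewrite -(@ae_eq_Rintegral (fun x => f x ^+ 2)) //; last first.
  - have F := ae_filter_ringOfSetsType mu.
    by apply: filterS fh => t ->.
  rewrite Rintegral_ge0 ?andTb; last by move=> t _; exact: sqr_ge0.
  have mI : measurable (`]x, y]%classic : set (measurableTypeR R)).
    exact: measurable_itv.
  have iI := integrableS measurableT mI (@subsetT _ _) i2.
  have fI := integrable_fin_num mI iI.
  rewrite /C /Rintegral fine_le//.
  - exact: integrable_fin_num i2.
  - apply: ge0_subset_integral => //.
    + exact/measurable_EFinP.
    + by move=> t _; rewrite lee_fin sqr_ge0.
exists C => x; have := bd 0 x; have := bd x 0; rewrite /prim ler_norml.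
move=> /andP[p0 pC] /andP[q0 qC].
by rewrite lerBrDl (le_trans _ q0) ?subr_le0//= lerBlDr ler_wpDr.
Qed.

End Primitive.

(** * Classical representatives of weak solutions *)

Section Regularity.
Variable R : realType.
Notation mu := (@lebesgue_measure R).
Implicit Types (f g h phi : R -> R) (s t x y : R).

Lemma test_function_derive phi : test_function phi ->
  test_function phi^`()%classic.
Proof.
move=> [dphi cphi]; split => [n x|].
  by rewrite -derive1Sn; exact: dphi.
apply: (subclosed_compact _ cphi); first exact: closed_closure.
rewrite [X in X `<=` _]closureE; apply: smallest_sub; first exact: closed_closure.
move=> x /= /eqP dx; apply: contrapT => xs; apply: dx.
have oC : open (~` closure [set x | phi x != 0]).
  by apply: closed_openC; exact: closed_closure.
have nx : nbhs x (~` closure [set x | phi x != 0]) by exact: open_nbhs_nbhs.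
rewrite derive1E (@near_eq_derive _ _ _ _ (cst (0 : R))) ?derive_cst//.
near=> y; apply/eqP; apply: contrapT => /negP py.
have : (~` closure [set x | phi x != 0]) y by near: y.
by apply; exact: subset_closure.
Unshelve. all: by end_near. Qed.

Lemma test_function_continuous phi : test_function phi -> continuous phi.
Proof.
move=> [dphi _] x; apply/differentiable_continuous/derivable1_diffP.
exact: (dphi 0).
Qed.

Lemma test_function_integrable f phi : locally_integrable setT f ->
  test_function phi -> mu.-integrable setT (EFin \o (fun x => f x * phi x)).
Proof.
move=> [mf _ lf] tphi; have cphi := test_function_continuous tphi.
case: tphi => _; set K := closure _ => cK.
have mK : measurable (K : set (measurableTypeR R)) by exact: compact_measurable.
have iK : mu.-integrable K (EFin \o f).
  apply/integrableP; split; last exact: lf.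
  by apply/measurable_EFinP; apply: measurable_funS mf.
have bK : [bounded phi x | x in K].
  have := compact_bounded (continuous_compact (continuous_subspaceT cphi) cK).
  by case=> M [rM hM]; exists M; split => // y yM x Kx; apply: hM => //; exists x.
have mphi : measurable_fun K phi.
  by apply: measurable_funS (continuous_measurable_fun cphi).
have := integrableMl mK iK mphi bK.
rewrite (integrable_mkcond _ mK); apply: eq_integrable => // x _.
rewrite patchE; case: ifPn => //= xK.
have -> : phi x = 0; last by rewrite mulr0.
apply/eqP; apply: contrapT => /negP px.
by move/negP: xK; apply; rewrite inE; exact: subset_closure.
Qed.

Lemma continuous_finsum (N : nat) (f : 'I_N -> R -> R) :
  (forall j, continuous (f j)) -> continuous (fun x => \sum_(j < N) f j x).
Proof.
move=> cf; elim: (index_enum _) => [|j r ih] x.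
  under eq_fun do rewrite big_nil; exact: cst_continuous.
under eq_fun do rewrite big_cons.
by apply: continuousD; [exact: cf|exact: ih].
Qed.

(** Reduced to a countable intersection over all natural numbers, with a vacuous condition beyond
    N. *)
Lemma ae_forall_ord (N : nat) (P : 'I_N -> R -> Prop) :
  (forall j, {ae mu, forall x, P j x}) -> {ae mu, forall x, forall j, P j x}.
Proof.
move=> aeP; have FF := ae_filter_ringOfSetsType mu.
have : {ae mu, forall x, forall n, forall j : 'I_N, j = n :> nat -> P j x}.
  apply: ae_foralln => n.
  have [nN|Nn] := ltnP n N.
    apply: filterS (aeP (Ordinal nN)) => x Px j jn.
    by rewrite (_ : j = Ordinal nN)//; apply: val_inj.
  by apply: aeW => x j jn; move: (ltn_ord j); rewrite jn ltnNge Nn.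
by apply: filterS => x Px j; exact: (Px j).
Qed.

(** Bootstrap: U = c + [prim g] is continuous, hence so is the weak derivative -F of g, and G = d +
    [prim] of -F is a C^1 representative of g. The last clause expresses that U and G are square
    integrable. *)
Lemma distributional_solution_regular (N : nat) (nu : 'I_N -> R)
    (u : 'I_N -> R -> R) :
  (forall i, H1 (u i)) -> distributional_solution nu u ->
  exists U G : 'I_N -> R -> R,
  [/\ forall i, {ae mu, forall x, u i x = U i x},
      forall i x, is_derive x 1 (U i) (G i x),
      forall i x, is_derive x 1 (G i)
        (- (2 * (\sum_(j < N) U j x ^+ 2) * U i x + nu i * U i x)) &
      forall i, exists F C, (forall x, is_derive x 1 F (U i x ^+ 2 + G i x ^+ 2))
        /\ forall x, `|F x| <= C].
Proof.
move=> uH usol; have FF := ae_filter_ringOfSetsType mu.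
have u2 i : u i \in Lfun mu 2%:E by case: (uH i).
have lu i := Lfun2_locally_integrable (u2 i).
have mu_ i := Lfun2_measurable (u2 i).
have /choice[g hg] i : exists g, g \in Lfun mu 2%:E /\ weak_derivative (u i) g.
  by have [_ [g g2 wg]] := uH i; exists g.
have lg i := Lfun2_locally_integrable (hg i).1.
have /choice[c hc] i := weak_derivative_prim (lu i) (lg i) (hg i).2.
pose U i x := c i + prim (g i) x.
have cU i : continuous (U i).
  by move=> x; apply: continuousD; [exact: cst_continuous|exact: continuous_prim].
pose F i x := 2 * (\sum_(j < N) U j x ^+ 2) * U i x + nu i * U i x.
have cF i : continuous (F i).
  move=> x; rewrite /continuous_at /F.
  apply: cvgD; last by apply: cvgM; [exact: cvg_cst|exact: cU].
  apply: cvgM; last exact: cU.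
  apply: cvgM; first exact: cvg_cst.
  by apply: (@continuous_finsum _ (fun j x => U j x ^+ 2)) => j y; exact: (continuousM (cU j y) (cU j y)).
have cNF i : continuous (fun x => - F i x).
  by move=> x; apply: continuousN; exact: cF.
have lF i := continuous_locally_integrable (cF i).
have lNF i := continuous_locally_integrable (cNF i).
have wg i : weak_derivative (g i) (fun x => - F i x).
  move=> phi tphi; have t1 := test_function_derive tphi.
  have t2 := test_function_derive t1.
  (* Testing with phi' replaces the integral of u phi'' by minus that of g phi', which turns the
     equation into one for g. *)
  have e1 := (hg i).2 _ t1.
  have := usol i _ tphi.
  set Fu := fun x => 2 * (\sum_(j < N) u j x ^+ 2) * u i x + nu i * u i x.
  have mFu : measurable_fun setT Fu.
    apply: measurable_funD; last exact: measurable_funM.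
    apply: measurable_funM => //; apply: measurable_funM => //.
    by apply: measurable_sum => j; exact: measurable_funX.
  have aeF : {ae mu, forall x, Fu x = F i x}.
    have : {ae mu, forall x, forall j, u j x = U j x} by exact: ae_forall_ord.
    apply: filterS => x hx; rewrite /Fu /F hx; congr (2 * _ * _ + _).
    by apply: eq_bigr => j _; rewrite hx.
  have mphi := continuous_measurable_fun (test_function_continuous tphi).
  have mphi2 := continuous_measurable_fun (test_function_continuous t2).
  have mF := continuous_measurable_fun (cF i).
  rewrite (@ae_eq_Rintegral _ _ (fun x => u i x * phi^`(2)%classic x + F i x * phi x))//; first last.
  - by apply: filterS aeF => x <-.
  - by apply: measurable_funD; exact: measurable_funM.
  - by apply: measurable_funD; exact: measurable_funM.
  rewrite RintegralD//; [|exact: test_function_integrable..].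
  rewrite [X in X + _ = _ -> _]e1 => /eqP; rewrite addr_eq0 => /eqP/oppr_inj ->.
  have iF := test_function_integrable (lF i) tphi.
  have := RintegralZl (-1) measurableT iF; rewrite mulN1r => h.
  apply: oppr_inj; rewrite opprK -h.
  by apply: eq_Rintegral => x _; rewrite mulN1r mulNr.
have /choice[d hd] i := weak_derivative_prim (lg i) (lNF i) (wg i).
pose G i x := d i + prim (fun x => - F i x) x.
have cG i : continuous (G i).
  by move=> x; apply: continuousD; [exact: cst_continuous|exact: continuous_prim].
exists U, G; split => //.
- move=> i x; rewrite -[G i x]add0r.
  by apply: is_deriveD; exact: (is_derive_prim (h := G i)).
- move=> i x; rewrite -[X in is_derive _ _ _ X]add0r.
  apply: is_deriveD; apply: (@is_derive_prim _ _ (fun x => - F i x)) => //.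
  exact: aeW.
- move=> i; have [C hC] := Lfun2_prim_sqr_bounded (u2 i) (cU i) (hc i).
  have [D hD] := Lfun2_prim_sqr_bounded (hg i).1 (cG i) (hd i).
  have dp h : continuous h -> forall x, is_derive x 1 (prim (fun x => h x ^+ 2)) (h x ^+ 2).
    move=> ch x; have ch2 : continuous (fun x => h x ^+ 2).
      by move=> y; exact: (continuousM (ch y) (ch y)).
    apply: (@is_derive_prim _ _ (fun x => h x ^+ 2)) => //; last exact: aeW.
    exact: continuous_locally_integrable.
  exists (prim (fun x => U i x ^+ 2) + prim (fun x => G i x ^+ 2)), (C + D).
  split=> x; first by apply: is_deriveD; exact: dp.
  by apply: le_trans (ler_normD _ _) _; apply: lerD.
Qed.

End Regularity.

(** * Gronwall lemmas and matrix-valued functions *)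

Section Calculus.
Variable R : realType.
Implicit Types (f g F E m : R -> R) (x y z : R).

Lemma is_derive_le0 f (df : R -> R) x y : (forall z, is_derive z 1 f (df z)) ->
  (forall z, df z <= 0) -> x <= y -> f y <= f x.
Proof.
move=> dF df0; rewrite le_eqVlt => /predU1P[->//|xy].
have [|c _ fE] := MVT xy (fun z _ => dF z).
  apply: continuous_subspaceT => z.
  by apply/differentiable_continuous/derivable1_diffP; case: (dF z).
by rewrite -subr_le0 fE mulr_le0_ge0 ?df0 ?subr_ge0 ?ltW.
Qed.

Lemma is_derive_ge0 f (df : R -> R) x y : (forall z, is_derive z 1 f (df z)) ->
  (forall z, 0 <= df z) -> x <= y -> f x <= f y.
Proof.
move=> dF df0 xy; rewrite -lerN2.
apply: (@is_derive_le0 (fun z => - f z) (fun z => - df z)) => // z.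
by rewrite oppr_le0.
Qed.

Lemma is_derive_weighted (E k dE dk : R -> R) :
  (forall x, is_derive x 1 E (dE x)) -> (forall x, is_derive x 1 k (dk x)) ->
  forall x, is_derive x 1 (fun y => E y * expR (- k y))
    ((dE x - dk x * E x) * expR (- k x)).
Proof.
move=> hE hk x.
have h := @is_derive1_comp _ expR (fun y => - k y) x _ _ (is_derive_expR _) (is_deriveN (hk x)).
apply: is_derive_eq (is_deriveM (hE x) h) _.
by rewrite /GRing.scale/=; ring.
Qed.

(** The product E e^{-k} is nonincreasing, and k >= 0 keeps the weight at most 1, so its value at x
    is bounded by E along the sequence, which tends to 0. *)
Lemma gronwall_Ny (E k dE dk : R -> R) (xs : nat -> R) :
  (forall x, is_derive x 1 E (dE x)) -> (forall x, is_derive x 1 k (dk x)) ->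
  (forall x, 0 <= E x) -> (forall x, 0 <= k x) ->
  (forall x, dE x <= dk x * E x) ->
  (forall X, \forall n \near \oo, xs n <= X) ->
  E (xs n) @[n --> \oo] --> (0 : R) ->
  forall x, E x = 0.
Proof.
move=> hE hk E0 k0 hEk xsN xs0 x; apply/eqP; rewrite eq_le E0 andbT.
have hw := is_derive_weighted hE hk.
have : E x * expR (- k x) <= 0.
  apply/ler_addgt0Pl => e e0; rewrite addr0.
  move/cvgrPdist_lt : xs0 => /(_ _ e0) small.
  near \oo => n.
  apply: (@le_trans _ _ (E (xs n) * expR (- k (xs n)))).
    apply: (is_derive_le0 hw); last by near: n; exact: xsN.
    by move=> z; rewrite mulr_le0_ge0 ?expR_ge0 ?subr_le0.
  apply: (@le_trans _ _ (E (xs n) * 1)).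
    by rewrite ler_wpM2l// -expR0 ler_expR oppr_le0.
  rewrite mulr1; apply: ltW; apply: le_lt_trans (ler_norm _) _.
  by rewrite -normrN -sub0r; near: n.
by rewrite pmulr_lle0// expR_gt0.
Unshelve. all: by end_near. Qed.

(** To the right of x0 the weight e^{-Cx} makes E nonincreasing, to the left e^{Cx} makes it
    nondecreasing. *)
Lemma gronwall_eq0 (E dE : R -> R) (C x0 : R) :
  (forall x, is_derive x 1 E (dE x)) -> (forall x, 0 <= E x) ->
  (forall x, `|dE x| <= C * E x) -> E x0 = 0 -> forall x, E x = 0.
Proof.
move=> hE E0 hC Ex0 x; apply/eqP; rewrite eq_le E0 andbT.
have hk := @is_derive_mull R.
have [xx0|xx0] := leP x0 x.
  have := is_derive_le0 (is_derive_weighted hE (hk C)) _ xx0.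
  rewrite Ex0 mul0r pmulr_lle0 ?expR_gt0//; apply => z.
  rewrite pmulr_lle0 ?expR_gt0// subr_le0.
  exact: le_trans (ler_norm _) (hC z).
have := is_derive_ge0 (is_derive_weighted hE (hk (- C))) _ (ltW xx0).
rewrite Ex0 mul0r pmulr_lle0 ?expR_gt0//; apply => z.
rewrite pmulr_lge0 ?expR_gt0// mulNr opprK -lerBlDr sub0r.
by have := hC z; rewrite ler_norml => /andP[].
Qed.

(** F is nondecreasing and bounded below, so its infimum b is its limit at -oo. *)
Lemma primitive_Ny f F C : (forall x, is_derive x 1 F (f x)) ->
  (forall x, 0 <= f x) -> (forall x, C <= F x) ->
  exists b, [/\ forall x, is_derive x 1 (fun y => F y - b) (f x),
    forall x, b <= F x & forall e, 0 < e -> exists X, forall x, x <= X -> F x < b + e].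
Proof.
move=> hF f0 FC; exists (inf (range F)).
have hi : has_inf (range F).
  split; first by exists (F 0), 0.
  by exists C => _ [y _ <-]; exact: FC.
split => [x|x|e e0].
- apply: is_derive_eq (is_deriveB (hF x) (is_derive_cst (inf (range F)) x 1)) _.
  by rewrite subr0.
- by apply: ge_inf; [case: hi|exists x].
- have [_ [X _ <-] hX] := inf_adherent e0 hi.
  exists X => x xX; apply: le_lt_trans hX.
  exact: is_derive_ge0 hF f0 xX.
Qed.

(** F + m is nondecreasing and F - m nonincreasing. Since m tends to 0 at -oo, both have there the
    same limit b, and S = F - b is squeezed between -m and m. *)
Lemma primitive_dominated f F g m : (forall x, is_derive x 1 F (f x)) ->
  (forall x, is_derive x 1 m (g x)) -> (forall x, `|f x| <= g x) ->
  (forall x, 0 <= m x) ->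
  (forall e, 0 < e -> exists X, forall x, x <= X -> m x < e) ->
  exists2 S, forall x, is_derive x 1 S (f x) & forall x, `|S x| <= m x.
Proof.
move=> hF hm fg m0 mN.
have fg' x : - g x <= f x <= g x by rewrite -ler_norml.
have hp x : is_derive x 1 (fun y => F y + m y) (f x + g x) by exact: is_deriveD.
have p0 x : 0 <= f x + g x by have /andP[? ?] := fg' x; lra.
have hn x : is_derive x 1 (fun y => F y - m y) (f x - g x) by exact: is_deriveB.
have n0 x : f x - g x <= 0 by have /andP[? ?] := fg' x; lra.
have lb x : F 0 - m 0 <= F x + m x.
  have [x0|x0] := leP 0 x.
    by have := is_derive_ge0 hp p0 x0; have := m0 0; lra.
  by have := is_derive_le0 hn n0 (ltW x0); have := m0 x; lra.
have [b [hb bF bN]] := primitive_Ny hp p0 lb.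
exists (fun y => F y - b) => [x|x].
  apply: is_derive_eq (is_deriveB (hF x) (is_derive_cst b x 1)) _.
  by rewrite subr0.
rewrite ler_norml; apply/andP; split; first by have := bF x; lra.
apply/ler_addgt0Pl => e e0; have [X hX] := bN e e0.
(* Far to the left, F(x) - m(x) <= F(y) - m(y) and F(y) + m(y) < b + e; adding them gives the upper
   bound up to e. *)
set y := Num.min x X.
have yx : y <= x by rewrite /y ge_min lexx.
have yX : y <= X by rewrite /y ge_min lexx orbT.
by have := is_derive_le0 hn n0 yx; have := hX y yX; have := m0 y; lra.
Qed.

End Calculus.

(* [move:], unlike [generalize], identifies products that differ only in the
   inferred algebraic structures. *)
Ltac mx_ring :=
  rewrite ?(mulmxDl, mulmxDr, mulmxBl, mulmxBr, mulNmx, mulmxN, mul1mx, mulmx1);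
  do 3 (rewrite -?scalemxAl -?scalemxAr
    ?(mulmxDl, mulmxDr, mulmxBl, mulmxBr, mulNmx, mulmxN, mul1mx, mulmx1));
  rewrite ?mulmxA;
  repeat match goal with |- context [?A *m ?B] => move: (A *m B) => ? end;
  apply/matrixP => ? ?; rewrite !mxE; ring.

(** * Entrywise calculus of matrix-valued functions *)

Section MatrixCalculus.
Variable R : realType.

Definition mderiv m n (M D : R -> 'M[R]_(m, n)) :=
  forall (x : R) i j, is_derive x 1 (fun y => M y i j) (D x i j).

Lemma mderiv_eq m n (M D D' : R -> 'M[R]_(m, n)) :
  mderiv M D -> (forall x, D x = D' x) -> mderiv M D'.
Proof. by move=> h e x i j; rewrite -e. Qed.

Lemma is_derive_finsum (I : Type) (r : seq I) (P : pred I)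
    (f df : I -> R -> R) (x : R) :
  (forall i, is_derive x 1 (f i) (df i x)) ->
  is_derive x 1 (fun y => \sum_(i <- r | P i) f i y) (\sum_(i <- r | P i) df i x).
Proof.
move=> h; elim: r => [|i r ih].
  rewrite big_nil; under eq_fun do rewrite big_nil; exact: is_derive_cst.
rewrite big_cons; under eq_fun do rewrite big_cons.
by case: ifP => // _; exact: is_deriveD.
Qed.

Lemma mderivM m n p (A A' : R -> 'M[R]_(m, n)) (B B' : R -> 'M[R]_(n, p)) :
  mderiv A A' -> mderiv B B' ->
  mderiv (fun x => A x *m B x) (fun x => A' x *m B x + A x *m B' x).
Proof.
move=> hA hB x i j; rewrite !mxE -big_split/=.
under eq_fun do rewrite mxE.
apply: (@is_derive_finsum _ _ _ _ (fun k y => A' y i k * B y k j + A y i k * B' y k j)) => k.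
apply: is_derive_eq (is_deriveM (hA x i k) (hB x k j)) _.
by rewrite /GRing.scale/= addrC; congr (_ + _); rewrite mulrC.
Qed.

Lemma mderivD m n (A A' B B' : R -> 'M[R]_(m, n)) :
  mderiv A A' -> mderiv B B' ->
  mderiv (fun x => A x + B x) (fun x => A' x + B' x).
Proof.
move=> hA hB x i j; rewrite mxE; under eq_fun do rewrite mxE.
exact: is_deriveD.
Qed.

Lemma mderivB m n (A A' B B' : R -> 'M[R]_(m, n)) :
  mderiv A A' -> mderiv B B' ->
  mderiv (fun x => A x - B x) (fun x => A' x - B' x).
Proof.
move=> hA hB x i j; rewrite !mxE; under eq_fun do rewrite !mxE.
exact: is_deriveB.
Qed.

Lemma mderivZ m n (a : R) (A A' : R -> 'M[R]_(m, n)) :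
  mderiv A A' -> mderiv (fun x => a *: A x) (fun x => a *: A' x).
Proof.
move=> hA x i j; rewrite !mxE; under eq_fun do rewrite !mxE.
exact: is_deriveZ.
Qed.

Lemma mderiv_tr m n (A A' : R -> 'M[R]_(m, n)) :
  mderiv A A' -> mderiv (fun x => (A x)^T) (fun x => (A' x)^T).
Proof. by move=> hA x i j; rewrite !mxE; under eq_fun do rewrite !mxE. Qed.

Lemma mderiv_cst m n (A : 'M[R]_(m, n)) : mderiv (fun=> A) (fun=> 0).
Proof. by move=> x i j; rewrite !mxE; exact: is_derive_cst. Qed.

Lemma mderiv_const_mul m n p (A : 'M[R]_(m, n)) (B B' : R -> 'M[R]_(n, p)) :
  mderiv B B' -> mderiv (fun x => A *m B x) (fun x => A *m B' x).
Proof.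
move=> hB; apply: mderiv_eq (mderivM (mderiv_cst A) hB) _ => x.
by rewrite mul0mx add0r.
Qed.

Definition mcvg m n (M : nat -> 'M[R]_(m, n)) (L : 'M[R]_(m, n)) :=
  forall i j, M k i j @[k --> \oo] --> L i j.

Lemma cvg_finsum (I : Type) (r : seq I) (P : pred I) (f : I -> nat -> R) (l : I -> R) :
  (forall i, f i n @[n --> \oo] --> l i) ->
  \sum_(i <- r | P i) f i n @[n --> \oo] --> \sum_(i <- r | P i) l i.
Proof.
move=> h; elim: r => [|i r ih].
  rewrite big_nil; under eq_fun do rewrite big_nil; exact: cvg_cst.
rewrite big_cons; under eq_fun do rewrite big_cons.
by case: ifP => // _; exact: cvgD.
Qed.

Lemma cvg_finprod (I : Type) (r : seq I) (P : pred I) (f : I -> nat -> R) (l : I -> R) :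
  (forall i, f i n @[n --> \oo] --> l i) ->
  \prod_(i <- r | P i) f i n @[n --> \oo] --> \prod_(i <- r | P i) l i.
Proof.
move=> h; elim: r => [|i r ih].
  rewrite big_nil; under eq_fun do rewrite big_nil; exact: cvg_cst.
rewrite big_cons; under eq_fun do rewrite big_cons.
by case: ifP => // _; exact: cvgM.
Qed.

Lemma mcvgM m n p (A : nat -> 'M[R]_(m, n)) (B : nat -> 'M[R]_(n, p)) LA LB :
  mcvg A LA -> mcvg B LB -> mcvg (fun k => A k *m B k) (LA *m LB).
Proof.
move=> hA hB i j; rewrite mxE; under eq_fun do rewrite mxE.
by apply: cvg_finsum => k; exact: cvgM.
Qed.

Lemma mcvgD m n (A B : nat -> 'M[R]_(m, n)) LA LB :
  mcvg A LA -> mcvg B LB -> mcvg (fun k => A k + B k) (LA + LB).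
Proof.
by move=> hA hB i j; rewrite mxE; under eq_fun do rewrite mxE; exact: cvgD.
Qed.

Lemma mcvgB m n (A B : nat -> 'M[R]_(m, n)) LA LB :
  mcvg A LA -> mcvg B LB -> mcvg (fun k => A k - B k) (LA - LB).
Proof.
by move=> hA hB i j; rewrite !mxE; under eq_fun do rewrite !mxE; exact: cvgB.
Qed.

Lemma mcvgZ m n (a : R) (A : nat -> 'M[R]_(m, n)) LA :
  mcvg A LA -> mcvg (fun k => a *: A k) (a *: LA).
Proof.
move=> hA i j; rewrite !mxE; under eq_fun do rewrite !mxE.
by apply: cvgM => //; exact: cvg_cst.
Qed.

Lemma mcvg_tr m n (A : nat -> 'M[R]_(m, n)) LA :
  mcvg A LA -> mcvg (fun k => (A k)^T) LA^T.
Proof. by move=> hA i j; rewrite !mxE; under eq_fun do rewrite !mxE; exact: hA. Qed.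

Lemma mcvg_cst m n (A : 'M[R]_(m, n)) : mcvg (fun=> A) A.
Proof. by move=> i j; exact: cvg_cst. Qed.

Lemma mcvg_det n (A : nat -> 'M[R]_n) LA :
  mcvg A LA -> \det (A k) @[k --> \oo] --> \det LA.
Proof.
move=> hA; rewrite /determinant; apply: cvg_finsum => s.
by apply: cvgM; [exact: cvg_cst|apply: cvg_finprod => i; exact: hA].
Qed.

(** The squared Frobenius norm, a sum of squares and so differentiable everywhere along a
    differentiable matrix path. *)
Definition sqnorm m n (A : 'M[R]_(m, n)) : R := \sum_i \sum_j A i j ^+ 2.

Lemma sqnorm_ge0 m n (A : 'M[R]_(m, n)) : 0 <= sqnorm A.
Proof. by apply: sumr_ge0 => i _; apply: sumr_ge0 => j _; exact: sqr_ge0. Qed.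

Lemma sqnorm_eq0 m n (A : 'M[R]_(m, n)) : sqnorm A = 0 -> A = 0.
Proof.
move=> A0; apply/matrixP => i j; rewrite mxE.
have i0 k : 0 <= \sum_l A k l ^+ 2 by apply: sumr_ge0 => l _; exact: sqr_ge0.
have h : \sum_l A i l ^+ 2 = 0 by apply: (psumr_eq0P _ A0) => // k _; exact: i0.
have : A i j ^+ 2 = 0 by apply: (psumr_eq0P _ h) => // l _; exact: sqr_ge0.
by move/eqP; rewrite sqrf_eq0 => /eqP.
Qed.

Lemma sqr_le_sqnorm m n (A : 'M[R]_(m, n)) i j : A i j ^+ 2 <= sqnorm A.
Proof.
rewrite /sqnorm (bigD1 i)//= (bigD1 j)//= -addrA lerDl addr_ge0//.
  by apply: sumr_ge0 => l _; exact: sqr_ge0.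
by apply: sumr_ge0 => k _; apply: sumr_ge0 => l _; exact: sqr_ge0.
Qed.

Lemma is_derive_sqnorm m n (A A' : R -> 'M[R]_(m, n)) : mderiv A A' ->
  forall x : R, is_derive x 1 (fun y => sqnorm (A y))
    (\sum_i \sum_j 2 * A x i j * A' x i j).
Proof.
move=> hA x; apply: (@is_derive_finsum _ _ _ _ (fun i y => \sum_j 2 * A y i j * A' y i j)) => i.
apply: (@is_derive_finsum _ _ _ _ (fun j y => 2 * A y i j * A' y i j)) => j.
apply: is_derive_eq (is_deriveM (hA x i j) (hA x i j)) _.
by rewrite /GRing.scale/=; ring.
Qed.

Lemma mcvg_sqnorm m n (A : nat -> 'M[R]_(m, n)) : mcvg A 0 ->
  sqnorm (A k) @[k --> \oo] --> (0 : R).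
Proof.
move=> hA; rewrite [X in _ --> X](_ : _ = sqnorm (0 : 'M[R]_(m, n))).
  apply: cvg_finsum => i; apply: cvg_finsum => j.
  exact: (cvgM (hA i j) (hA i j)).
by rewrite /sqnorm big1// => i _; rewrite big1// => j _; rewrite mxE expr0n.
Qed.

End MatrixCalculus.

(** * Dressing of decaying solutions *)

Section DressingAlgebra.
Variables (R : comPzRingType) (n : nat) (H P : 'M[R]_n) (p q : 'cV[R]_n).
Let r := q + H *m p - 2 *: (P *m (H *m p)).
Let Z := P *m H + H *m P - 2 *: (P *m (H *m P)) - p *m p^T.

(** For p = psi, q = psi' and P' = - p p^T, the left side is the derivative of the defect r once
    psi'' is replaced using the equation. Being linear in the defects r and Z, it is open to a
    Gronwall argument. *)
Lemma dressing_vector_identity :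
  H *m (H *m p) - 4 *: (p *m (p^T *m (H *m p))) + H *m q -
    2 *: (- (p *m p^T) *m (H *m p) + P *m (H *m q)) =
  (H - 2 *: (P *m H)) *m r + 2 *: (Z *m (H *m p)).
Proof. rewrite /r /Z. mx_ring. Qed.

(** The left side is the derivative of the defect Z as the product rule produces it; the term
    [P *m 0] comes from the constant factor H. *)
Lemma dressing_matrix_identity : H^T = H -> P^T = P ->
  - (p *m p^T) *m H + P *m 0 + H *m - (p *m p^T) -
   2 *: (- (p *m p^T) *m (H *m P) + P *m (H *m - (p *m p^T))) -
   (q *m p^T + p *m q^T) =
  - (r *m p^T) - p *m r^T.
Proof.
move=> hH hP.
have -> : r^T = q^T + p^T *m H - 2 *: (p^T *m H *m P).
  have pH : (H *m p)^T = p^T *m H by rewrite trmx_mul hH.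
  have pHP : (P *m (H *m p))^T = p^T *m H *m P by rewrite trmx_mul pH hP.
  by rewrite -pHP -pH /r; apply/matrixP => i j; rewrite !mxE.
rewrite /r mulmx0 addr0. mx_ring.
Qed.

End DressingAlgebra.

(** * Energy estimate for the defects *)

Section EnergyEstimate.
Variable R : realType.

Lemma young_mul (e a b : R) : 0 < e -> 2 * (a * b) <= e * a ^+ 2 + e^-1 * b ^+ 2.
Proof.
move=> e0; rewrite -subr_ge0.
have -> : e * a ^+ 2 + e^-1 * b ^+ 2 - 2 * (a * b) = e^-1 * (e * a - b) ^+ 2.
  by field; rewrite gt_eqF.
by rewrite mulr_ge0 ?sqr_ge0// invr_ge0 ltW.
Qed.

(** These are the cross terms at one pair (i, j) in the derivative of |r|^2 + |Q|^2. Young's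
    inequality leaves only a multiple e of the squares of r, for the damping to absorb, and moves
    the factor 1/e to q^2, whose coefficient t will be |psi|^2, integrable in x. *)
Lemma coupling_le (e h mu t eta g ri rj q pi pj : R) : 0 < e ->
  0 <= eta <= h -> `|g| <= mu -> pi ^+ 2 <= t -> pj ^+ 2 <= t ->
  4 * g * eta * ri * rj + 4 * eta * ri * q * pj - 2 * q * ri * pj - 2 * q * pi * rj
  <= 2 * mu * h * (ri ^+ 2 + rj ^+ 2) + e * (2 * ri ^+ 2 + rj ^+ 2)
     + e^-1 * (4 * h ^+ 2 + 2) * t * q ^+ 2.
Proof.
move=> e0 /andP[eta0 etah] gmu pit pjt.
have ei0 : 0 <= e^-1 by rewrite invr_ge0 ltW.
have h0 : 0 <= h := le_trans eta0 etah.
have mu0 : 0 <= mu := le_trans (normr_ge0 g) gmu.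
have A1 : 4 * g * eta * ri * rj <= 2 * mu * h * (ri ^+ 2 + rj ^+ 2).
  have ge : `|g * eta| <= mu * h.
    by rewrite normrM (ger0_norm eta0) ler_pM.
  have rr : `|2 * (ri * rj)| <= ri ^+ 2 + rj ^+ 2.
    have := sqr_ge0 (ri - rj); have := sqr_ge0 (ri + rj); rewrite ler_norml => ? ?.
    by apply/andP; split; nra.
  have key : g * eta * (2 * (ri * rj)) <= mu * h * (ri ^+ 2 + rj ^+ 2).
    by apply: le_trans (ler_norm _) _; rewrite normrM ler_pM.
  by lra.
have A2 : 4 * eta * ri * q * pj <= e * ri ^+ 2 + e^-1 * (4 * h ^+ 2 * (t * q ^+ 2)).
  have -> : 4 * eta * ri * q * pj = 2 * (ri * (2 * eta * q * pj)) by ring.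
  apply: le_trans (young_mul _ _ e0) _; rewrite lerD2l ler_wpM2l//.
  have -> : (2 * eta * q * pj) ^+ 2 = (4 * eta ^+ 2) * (pj ^+ 2 * q ^+ 2) by ring.
  apply: ler_pM; [by rewrite mulr_ge0 ?sqr_ge0|by rewrite mulr_ge0 ?sqr_ge0| |].
    by rewrite ler_wpM2l// ler_pXn2r ?nnegrE.
  by rewrite ler_wpM2r ?sqr_ge0.
have A3 : - (2 * q * ri * pj) <= e * ri ^+ 2 + e^-1 * (t * q ^+ 2).
  have -> : - (2 * q * ri * pj) = 2 * (ri * (- (q * pj))) by ring.
  apply: le_trans (young_mul _ _ e0) _; rewrite lerD2l ler_wpM2l//.
  by rewrite sqrrN exprMn mulrC ler_wpM2r ?sqr_ge0.
have A4 : - (2 * q * pi * rj) <= e * rj ^+ 2 + e^-1 * (t * q ^+ 2).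
  have -> : - (2 * q * pi * rj) = 2 * (rj * (- (q * pi))) by ring.
  apply: le_trans (young_mul _ _ e0) _; rewrite lerD2l ler_wpM2l//.
  by rewrite sqrrN exprMn mulrC ler_wpM2r ?sqr_ge0.
move: (e^-1) A2 A3 A4 => ei A2 A3 A4; clear -A1 A2 A3 A4.
have := lerD (lerD A1 A2) (lerD A3 A4); congr (_ <= _); ring.
Qed.

Lemma sum_sqr_row n (p : 'cV[R]_n) : \sum_i \sum_(j < n) p i 0 ^+ 2 = n%:R * sqnorm p.
Proof.
rewrite mulr_sumr; apply: eq_bigr => i _.
by rewrite sumr_const card_ord big_ord1 mulr_natl.
Qed.

Lemma sum_sqr_col n (p : 'cV[R]_n) : \sum_(i < n) \sum_j p j 0 ^+ 2 = n%:R * sqnorm p.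
Proof. by rewrite exchange_big/= sum_sqr_row. Qed.

Lemma energy_estimate n (eta : 'I_n -> R) (G Q : 'M[R]_n) (r p : 'cV[R]_n)
    (e d h mu : R) : let H := diag_mx (\row_j eta j) in
  0 < e -> 0 <= d -> (forall i, d <= eta i <= h) -> (forall i j, `|G i j| <= mu) ->
  \sum_i \sum_j 2 * r i j *
    (2 *: (G *m (H *m r)) - H *m r + 2 *: (Q *m (H *m p))) i j +
  \sum_i \sum_j 2 * Q i j * (- (r *m p^T) - p *m r^T) i j <=
  (4 * mu * h * n%:R + 3 * e * n%:R - 2 * d) * sqnorm r +
  e^-1 * (4 * h ^+ 2 + 2) * sqnorm p * sqnorm Q.
Proof.
move=> H e0 d0 etadh Gmu.
have HE (w : 'cV[R]_n) i : (H *m w) i 0 = eta i * w i 0 by rewrite mul_diag_mx !mxE.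
(* The derivative is split into the damping coming from - H r and the pairwise couplings estimated
   above. *)
have -> : \sum_i \sum_j 2 * r i j *
    (2 *: (G *m (H *m r)) - H *m r + 2 *: (Q *m (H *m p))) i j +
  \sum_i \sum_j 2 * Q i j * (- (r *m p^T) - p *m r^T) i j =
  \sum_i (- 2 * (eta i * r i 0 ^+ 2)) + \sum_i \sum_j
   (4 * G i j * eta j * r i 0 * r j 0 + 4 * eta j * r i 0 * Q i j * p j 0
    - 2 * Q i j * r i 0 * p j 0 - 2 * Q i j * p i 0 * r j 0).
  rewrite -!big_split/=; apply: eq_bigr => i _; rewrite big_ord1.
  have -> : (2 *: (G *m (H *m r)) - H *m r + 2 *: (Q *m (H *m p))) i 0 =
    \sum_j (2 * (G i j * (eta j * r j 0)) + 2 * (Q i j * (eta j * p j 0))) - eta i * r i 0.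
    rewrite big_split/= -!mulr_sumr -HE !mxE addrAC.
    by congr (_ + _ - _); congr (2 * _); apply: eq_bigr => j _; rewrite HE.
  rewrite mulrBr mulr_sumr addrAC -big_split/= addrC; congr (_ + _); first by ring.
  apply: eq_bigr => j _; rewrite !mxE !big_ord1 !mxE; ring.
apply: (@le_trans _ _ (\sum_i (- 2 * (d * r i 0 ^+ 2)) + \sum_i \sum_j
   (2 * mu * h * (r i 0 ^+ 2 + r j 0 ^+ 2) + e * (2 * r i 0 ^+ 2 + r j 0 ^+ 2)
     + e^-1 * (4 * h ^+ 2 + 2) * sqnorm p * Q i j ^+ 2))).
  apply: lerD.
    apply: ler_sum => i _; rewrite ler_nM2l ?oppr_lt0// ler_wpM2r ?sqr_ge0//.
    by case/andP: (etadh i).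
  apply: ler_sum => i _; apply: ler_sum => j _; apply: coupling_le => //.
  - by case/andP: (etadh j) => a b; rewrite b andbT (le_trans d0).
  - exact: sqr_le_sqnorm.
  - exact: sqr_le_sqnorm.
have -> : \sum_i \sum_j (2 * mu * h * (r i 0 ^+ 2 + r j 0 ^+ 2) +
     e * (2 * r i 0 ^+ 2 + r j 0 ^+ 2)
     + e^-1 * (4 * h ^+ 2 + 2) * sqnorm p * Q i j ^+ 2) =
   (2 * mu * h + 2 * e) * (\sum_i \sum_(j < n) r i 0 ^+ 2) +
   (2 * mu * h + e) * (\sum_(i < n) \sum_j r j 0 ^+ 2) +
   e^-1 * (4 * h ^+ 2 + 2) * sqnorm p * sqnorm Q.
  rewrite /sqnorm [in RHS]mulr_sumr [X in _ + X + _]mulr_sumr [X in _ + _ + X]mulr_sumr.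
  rewrite -!big_split/=; apply: eq_bigr => i _.
  rewrite [in RHS]mulr_sumr [X in _ + X + _]mulr_sumr [X in _ + _ + X]mulr_sumr.
  by rewrite -!big_split/=; apply: eq_bigr => j _; ring.
rewrite sum_sqr_row sum_sqr_col.
have -> : \sum_i (- 2 * (d * r i 0 ^+ 2)) = - 2 * d * sqnorm r.
  by rewrite mulr_sumr; apply: eq_bigr => i _; rewrite big_ord1 mulrA.
rewrite le_eqVlt; apply/orP; left; apply/eqP; ring.
Qed.

End EnergyEstimate.

(** * Sequences along which the energy density vanishes *)

Section TailSequence.
Variable R : realType.
Implicit Types x z : R.

Lemma small_derivative_Ny (F s : R -> R) (C : R) :
  (forall x, is_derive x 1 F (s x)) -> (forall x, `|F x| <= C) ->
  forall e X, 0 < e -> exists2 x, x <= X & s x < e.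
Proof.
move=> dF FC e X e0; apply: contrapT => nex.
have se x : x <= X -> e <= s x.
  by move=> xX; rewrite leNgt; apply/negP => sx; apply: nex; exists x.
have C0 : 0 <= C by apply: le_trans (FC 0).
(* If s >= e on the whole half-line, then over an interval of this length F would grow by 2 C + 1,
   more than its bound C allows. *)
set k := (2 * C + 1) / e.
have k0 : 0 < k by rewrite divr_gt0//; lra.
have kX : X - k < X by lra.
have [|c] := MVT kX (fun (z : R) _ => dF z).
  apply: continuous_subspaceT => z.
  by apply/differentiable_continuous/derivable1_diffP; case: (dF z).
rewrite in_itv/= => /andP[_ /ltW/se sc] FE.
have : 2 * C + 1 <= F X - F (X - k).
  rewrite FE (_ : X - (X - k) = k); last by ring.
  by rewrite -(@ler_pdivrMr _ k)// /k invf_div mulrC divfK// gt_eqF//; lra.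
have := FC X; have := FC (X - k); rewrite !ler_norml => /andP[? ?] /andP[? ?] ?.
lra.
Qed.

(** An integrable density need not have a limit at -oo; convergence along a sequence is enough for
    [gronwall_Ny]. *)
Lemma small_derivative_seq (F s : R -> R) (C : R) :
  (forall x, is_derive x 1 F (s x)) -> (forall x, `|F x| <= C) ->
  (forall x, 0 <= s x) ->
  exists xs : nat -> R, (forall X, \forall n \near \oo, xs n <= X) /\
    s (xs n) @[n --> \oo] --> (0 : R).
Proof.
move=> dF FC s0.
have /choice[xs hxs] n : exists x, x <= - n%:R /\ s x < n.+1%:R^-1.
  have [|x xn sx] := small_derivative_Ny dF FC (- n%:R) (_ : 0 < n.+1%:R^-1).
    by rewrite invr_gt0 ltr0n.
  by exists x.
exists xs; split.
  move=> X; near=> n; apply: le_trans (hxs n).1 _.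
  by rewrite lerNl; near: n; exact: nbhs_infty_ger.
apply: (squeeze_cvgr _ (cvg_cst (0 : R)) (@cvg_harmonic R)).
by near=> n; rewrite s0 /harmonic ltW// (hxs n).2.
Unshelve. all: by end_near. Qed.

End TailSequence.

Lemma is_derive_expRM (R : realType) (a x : R) :
  is_derive x (1 : R) (fun y => expR (a * y)) (a * expR (a * x)).
Proof.
apply: is_derive_eq (is_derive1_comp (is_derive_expR _) (is_derive_mull a x)) _.
exact: mulrC.
Qed.

(** * From a decaying solution to a Cauchy matrix system *)

Section Soliton.
Variables (R : realType) (N : nat) (eta : 'I_N -> R) (psi psid : R -> 'cV[R]_N).
Implicit Types x z : R.
Hypothesis eta_gt0 : forall i, 0 < eta i.
Let H : 'M[R]_N := diag_mx (\row_j eta j).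
Hypothesis dpsi : mderiv psi psid.
Hypothesis dpsid : mderiv psid (fun x =>
  H *m (H *m psi x) - 4 *: (psi x *m ((psi x)^T *m (H *m psi x)))).
Variables (m : R -> R) (mC : R) (xs : nat -> R).
Let s x := sqnorm (psi x) + sqnorm (psid x).
Hypothesis dm : forall x, is_derive x 1 m (s x).
Hypothesis m_ge0 : forall x, 0 <= m x.
Hypothesis m_le : forall x, m x <= mC.
Hypothesis m_Ny : forall e, 0 < e -> exists X, forall x, x <= X -> m x < e.
Hypothesis xs_Ny : forall X, \forall n \near \oo, xs n <= X.
Hypothesis s_xs : s (xs n) @[n --> \oo] --> (0 : R).

Lemma energy_density_ge0 x : 0 <= s x.
Proof. by rewrite addr_ge0 ?sqnorm_ge0. Qed.

Lemma mcvg_sqnorm0 p q (A : nat -> 'M[R]_(p, q)) (b : nat -> R) :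
  b n @[n --> \oo] --> (0 : R) -> (forall n, sqnorm (A n) <= b n) -> mcvg A 0.
Proof.
move=> hb hA i j; rewrite mxE; apply/cvgrPdist_lt => e e0.
move/cvgrPdist_lt : hb => /(_ (e ^+ 2)); rewrite exprn_gt0// => /(_ isT) hb.
near=> n; rewrite sub0r normrN -(@ltr_pXn2r _ 2)// ?nnegrE ?(ltW e0)//.
rewrite real_normK ?num_real//; apply: le_lt_trans (sqr_le_sqnorm _ i j) _.
apply: le_lt_trans (hA n) _; apply: le_lt_trans (ler_norm _) _.
by rewrite -normrN -sub0r; near: n.
Unshelve. all: by end_near. Qed.

Lemma psi_xs : mcvg (fun n => psi (xs n)) 0.
Proof. by apply: mcvg_sqnorm0 s_xs _ => n; rewrite lerDl sqnorm_ge0. Qed.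

Lemma psid_xs : mcvg (fun n => psid (xs n)) 0.
Proof. by apply: mcvg_sqnorm0 s_xs _ => n; rewrite lerDr sqnorm_ge0. Qed.

Lemma m_xs : m (xs n) @[n --> \oo] --> (0 : R).
Proof.
apply/cvgrPdist_lt => e e0; have [X hX] := m_Ny e0.
near=> n; rewrite sub0r normrN ger0_norm//; apply: hX.
by near: n; exact: xs_Ny.
Unshelve. all: by end_near. Qed.

Lemma psi_mul_le x i j : `|psi x i 0 * psi x j 0| <= s x.
Proof.
have h : sqnorm (psi x) <= s x by rewrite lerDl sqnorm_ge0.
apply: le_trans h.
have a := sqr_le_sqnorm (psi x) i 0; have b := sqr_le_sqnorm (psi x) j 0.
move: (psi x i 0) (psi x j 0) (sqnorm _) a b => p q t a b.
have := sqr_ge0 (p - q); have := sqr_ge0 (p + q); rewrite ler_norml => ? ?.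
by apply/andP; split; nra.
Qed.

Lemma dressing_exists : exists G : R -> 'M[R]_N,
  [/\ mderiv G (fun x => psi x *m (psi x)^T),
      forall x i j, `|G x i j| <= m x & forall x, (G x)^T = G x].
Proof.
have cpsi i : continuous (fun x => psi x i 0).
  move=> x; apply/differentiable_continuous/derivable1_diffP.
  by case: (dpsi x i 0).
have /choice[S hS] (ij : 'I_N * 'I_N) : exists S, (forall x : R, is_derive x 1 S (psi x ij.1 0 * psi x ij.2 0)) /\ forall x, `|S x| <= m x.
  have [F dF] := @continuous_primitive R (fun x => psi x ij.1 0 * psi x ij.2 0)
     (fun x => continuousM (cpsi ij.1 x) (cpsi ij.2 x)).
  have [S dS Sm] := primitive_dominated dF dm (fun x => psi_mul_le x _ _) m_ge0 m_Ny.
  by exists S.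
(* Primitives are chosen for ordered pairs only, so that the matrix is symmetric by construction. *)
exists (fun x => \matrix_(i, j) (if (i <= j)%N then S (i, j) x else S (j, i) x)); split.
- move=> x i j; under eq_fun do rewrite mxE.
  rewrite mxE big_ord1 !mxE; case: leqP => _; first exact: (hS (i, j)).1.
  by rewrite mulrC; exact: (hS (j, i)).1.
- by move=> x i j; rewrite mxE; case: leqP => _; exact: (hS _).2.
- move=> x; apply/matrixP => i j; rewrite !mxE.
  by case: ltngtP => // /val_inj ->.
Qed.

(* [G] is the integral of [psi psi^T] from -oo; as a primitive of the energy
   density vanishing at -oo, [m] dominates its entries. *)
Variable G : R -> 'M[R]_N.
Hypothesis dG : mderiv G (fun x => psi x *m (psi x)^T).
Hypothesis G_le : forall x i j, `|G x i j| <= m x.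
Hypothesis G_tr : forall x, (G x)^T = G x.
Let P x := 1%:M - G x.
Let Rr x := psid x + H *m psi x - 2 *: (P x *m (H *m psi x)).
Let Q x := P x *m H + H *m P x - 2 *: (P x *m (H *m P x)) - psi x *m (psi x)^T.

Lemma mderiv_dressing : mderiv P (fun x => - (psi x *m (psi x)^T)).
Proof. by apply: mderiv_eq (mderivB (mderiv_cst _) dG) _ => x; rewrite sub0r. Qed.

Lemma tr_dressing x : (P x)^T = P x.
Proof.
apply/matrixP => i j; rewrite /P -[in RHS](G_tr x) -[in RHS]trmx1.
by rewrite !mxE.
Qed.

Lemma tr_spectrum : H^T = H.
Proof. exact: tr_diag_mx. Qed.

Lemma mderiv_vector_defect : mderiv Rr (fun x =>
  (H - 2 *: (P x *m H)) *m Rr x + 2 *: (Q x *m (H *m psi x))).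
Proof.
have h1 := mderiv_const_mul H dpsi.
apply: mderiv_eq (mderivB (mderivD dpsid h1) (mderivZ 2 (mderivM mderiv_dressing h1))) _ => x.
exact: dressing_vector_identity.
Qed.

Lemma mderiv_matrix_defect : mderiv Q (fun x => - (Rr x *m (psi x)^T) - psi x *m (Rr x)^T).
Proof.
have h1 := mderiv_const_mul H mderiv_dressing.
have h2 := mderivM mderiv_dressing (mderiv_cst H).
have h3 := mderivM mderiv_dressing h1.
have h4 := mderivM dpsi (mderiv_tr dpsi).
apply: mderiv_eq (mderivB (mderivB (mderivD h2 h1) (mderivZ 2 h3)) h4) _ => x.
exact: (dressing_matrix_identity _ _ tr_spectrum (tr_dressing x)).
Qed.

Lemma G_xs : mcvg (fun n => G (xs n)) 0.
Proof.
move=> i j; rewrite mxE; apply/cvgrPdist_le => e e0.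
move/cvgrPdist_le : m_xs => /(_ e e0) h.
near=> n; rewrite sub0r normrN; apply: le_trans (G_le _ _ _) _.
apply: le_trans (ler_norm _) _; rewrite -normrN -sub0r; near: n; exact: h.
Unshelve. all: by end_near. Qed.

Lemma dressing_xs : mcvg (fun n => P (xs n)) 1%:M.
Proof. by have := mcvgB (@mcvg_cst _ _ _ 1%:M) G_xs; rewrite subr0. Qed.

Lemma vector_defect_xs : mcvg (fun n => Rr (xs n)) 0.
Proof.
have h := mcvgM (@mcvg_cst _ _ _ H) psi_xs.
have := mcvgB (mcvgD psid_xs h) (@mcvgZ _ _ _ 2 _ _ (mcvgM dressing_xs h)).
by rewrite mulmx0 mulmx0 scaler0 addr0 subr0.
Qed.

Lemma matrix_defect_xs : mcvg (fun n => Q (xs n)) 0.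
Proof.
have h := mcvgM (@mcvg_cst _ _ _ H) dressing_xs.
have := mcvgB (mcvgB (mcvgD (mcvgM dressing_xs (@mcvg_cst _ _ _ H)) h) (@mcvgZ _ _ _ 2 _ _ (mcvgM dressing_xs h)))
  (mcvgM psi_xs (mcvg_tr psi_xs)).
by rewrite mul0mx !mul1mx !mulmx1 subr0 scaler_nat mulr2n subrr.
Qed.

Lemma eta_bounds : exists d h, [/\ 0 < d, 0 <= h & forall i, d <= eta i <= h].
Proof.
have inv0 i : 0 <= (eta i)^-1 by rewrite invr_ge0 ltW.
have S0 : 0 <= \sum_i (eta i)^-1 by apply: sumr_ge0.
(* Explicit bounds, which make sense also when there is no index at all. *)
exists (1 + \sum_i (eta i)^-1)^-1, (\sum_i eta i); split.
- by rewrite invr_gt0 ltr_wpDr.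
- by apply: sumr_ge0 => i _; exact: ltW.
- move=> i; apply/andP; split.
    rewrite invf_ple ?posrE ?ltr_wpDr// (bigD1 i)//= addrCA lerDl addr_ge0//.
    by apply: sumr_ge0.
  by rewrite (bigD1 i)//= lerDl; apply: sumr_ge0 => j _; exact: ltW.
Qed.

Lemma defects_eq0 x : Rr x = 0 /\ Q x = 0.
Proof.
have [d [h [d0 h0 dh]]] := eta_bounds.
have N1 : 0 < 3 * N%:R + 1 :> R by rewrite ltr_wpDl// mulr_ge0.
(* Chosen so that 3 e N <= d: Young's error uses up at most half of the damping 2 d. *)
pose e := d / (3 * N%:R + 1).
have e0 : 0 < e by rewrite divr_gt0.
have eN : 3 * e * N%:R <= d.
  have -> : 3 * e * N%:R = d - e by rewrite /e; field; rewrite gt_eqF.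
  by rewrite gerBl ltW.
have hN1 : 0 < 4 * h * N%:R + 1 by rewrite ltr_wpDl// !mulr_ge0.
(* To the left of [X0] the term 4 m h N is at most d, and the remaining damping dominates it. *)
have [X0 hX0] := m_Ny (divr_gt0 d0 hN1).
have mC0 : 0 <= mC := le_trans (m_ge0 0) (m_le 0).
pose C := e^-1 * (4 * h ^+ 2 + 2).
have C0 : 0 <= C by rewrite mulr_ge0 ?invr_ge0 ?(ltW e0)// addr_ge0// mulr_ge0 ?sqr_ge0.
(* [G] is small only near -oo: the term [L e^z] of the Gronwall weight absorbs
   the growth of the energy beyond [X0]. *)
pose L := 4 * mC * h * N%:R * expR (- X0).
have L0 : 0 <= L by rewrite /L !mulr_ge0 ?expR_ge0.
have kL z : 4 * m z * h * N%:R - d <= L * expR z.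
  have [zX|Xz] := leP z X0.
    apply: (@le_trans _ _ 0); last by rewrite mulr_ge0 ?expR_ge0.
    rewrite subr_le0; have := hX0 z zX; rewrite ltr_pdivlMr// => /ltW.
    by apply: le_trans; rewrite mulrDr mulr1 ler_wpDr// le_eqVlt; apply/orP; left; apply/eqP; ring.
  apply: (@le_trans _ _ (4 * mC * h * N%:R)).
    rewrite lerBlDr ler_wpDr ?(ltW d0)//.
    by rewrite ler_wpM2r// ler_wpM2r// ler_wpM2l.
  rewrite /L -(mulrA _ (expR _)) -expRD -[leLHS]mulr1 ler_wpM2l ?mulr_ge0//.
  by rewrite -expR0 ler_expR addrC subr_ge0 ltW.
have dE z := is_deriveD (is_derive_sqnorm mderiv_vector_defect z) (is_derive_sqnorm mderiv_matrix_defect z).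
(* In the derivative of this weight, C s bounds the coefficient of |Q|^2 in the energy estimate and
   L e^z that of |r|^2. *)
have dk (z : R) : is_derive z 1 (fun y => C * m y + L * expR y) (C * s z + L * expR z).
  exact: is_deriveD (is_deriveZ C (dm z)) (is_deriveZ L (is_derive_expR z)).
have E0 z : 0 <= sqnorm (Rr z) + sqnorm (Q z) by rewrite addr_ge0 ?sqnorm_ge0.
have k0 z : 0 <= C * m z + L * expR z.
  by apply: addr_ge0; apply: mulr_ge0 => //; exact: expR_ge0.
have dEk z : \sum_i \sum_j 2 * Rr z i j *
      ((H - 2 *: (P z *m H)) *m Rr z + 2 *: (Q z *m (H *m psi z))) i j +
    \sum_i \sum_j 2 * Q z i j * (- (Rr z *m (psi z)^T) - psi z *m (Rr z)^T) i j <=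
    (C * s z + L * expR z) * (sqnorm (Rr z) + sqnorm (Q z)).
  have -> : (H - 2 *: (P z *m H)) *m Rr z =
      2 *: (G z *m (H *m Rr z)) - H *m Rr z by rewrite /P; mx_ring.
  apply: le_trans (energy_estimate (G := G z) (mu := m z) _ _ _ e0 (ltW d0) dh (G_le z)) _.
  rewrite [leRHS]mulrDr; apply: lerD; apply: ler_wpM2r; rewrite ?sqnorm_ge0//.
    apply: (@le_trans _ _ (4 * m z * h * N%:R - d)); first by lra.
    by apply: le_trans (kL z) _; rewrite lerDr mulr_ge0// energy_density_ge0.
  apply: (@le_trans _ _ (C * s z)); first by rewrite ler_wpM2l// lerDl sqnorm_ge0.
  by rewrite lerDl mulr_ge0 ?expR_ge0.
have Exs : sqnorm (Rr (xs n)) + sqnorm (Q (xs n)) @[n --> \oo] --> (0 : R).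
  by rewrite -[X in _ --> X]addr0; apply: cvgD; apply: mcvg_sqnorm; [exact: vector_defect_xs|exact: matrix_defect_xs].
have := gronwall_Ny dE dk E0 k0 dEk xs_Ny Exs x.
move=> /eqP; rewrite paddr_eq0 ?sqnorm_ge0// => /andP[/eqP r0 /eqP q0].
by split; exact: sqnorm_eq0.
Qed.

Let flow x : 'M[R]_N := diag_mx (\row_j expR (eta j * x)).

Lemma mderiv_flow : mderiv flow (fun x => H *m flow x).
Proof.
move=> x i j; under eq_fun do rewrite !mxE; rewrite mul_diag_mx !mxE.
case: eqVneq => [->|_].
  rewrite !mulr1n; exact: is_derive_expRM.
by rewrite mulr0n mulr0; under eq_fun do rewrite mulr0n; exact: is_derive_cst.
Qed.

Lemma mderiv_flow_mul (c : 'cV[R]_N) :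
  mderiv (fun x => flow x *m c) (fun x => H *m (flow x *m c)).
Proof.
apply: mderiv_eq (mderivM mderiv_flow (mderiv_cst c)) _ => x.
by rewrite mulmx0 addr0 mulmxA.
Qed.

Lemma flowN x : flow x *m flow (- x) = 1%:M.
Proof.
apply/matrixP => i j; rewrite mul_diag_mx !mxE.
by case: eqVneq => [->|_]; rewrite ?mulr0// !mulr1n mulrN -expRD subrr expR0.
Qed.

(** P tends to the identity along the sequence, so its determinant is eventually nonzero. *)
Lemma dressing_unit_ex : exists x0, P x0 \in unitmx.
Proof.
have := mcvg_det dressing_xs; rewrite det1 => /cvgrPdist_lt /(_ 1 ltr01) h.
near \oo => n; exists (xs n); rewrite unitmxE unitfE.
apply/eqP => d0; have : `|1 - \det (P (xs n))| < 1 by near: n; exact: h.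
by rewrite d0 subr0 normr1 ltxx.
Unshelve. all: by end_near. Qed.

Lemma dressing_flow : exists c : 'cV[R]_N, forall x, psi x = P x *m (flow x *m c).
Proof.
have [x0 Pu] := dressing_unit_ex.
(* This c makes psi and P v agree at [x0]; uniqueness for the linear equation they share extends the
   equality to the line. *)
exists (flow (- x0) *m (invmx (P x0) *m psi x0)); set c := _ *m _ => x.
apply/eqP; rewrite -subr_eq0; apply/eqP/sqnorm_eq0.
have [d [h [d0 h0 dh]]] := eta_bounds.
have mC0 : 0 <= mC := le_trans (m_ge0 0) (m_le 0).
pose L y := 2 *: (P y *m H) - H.
have dD := mderivB dpsi (mderivM mderiv_dressing (mderiv_flow_mul c)).
have {}dD : mderiv (fun y => psi y - P y *m (flow y *m c))
    (fun y => L y *m (psi y - P y *m (flow y *m c))).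
  apply: mderiv_eq dD _ => y; have [r0 q0] := defects_eq0 y.
  (* The vanishing of the two defects expresses psi' and psi psi^T through P and H, which closes the
     equation for psi - P v. *)
  have -> : psid y = 2 *: (P y *m (H *m psi y)) - H *m psi y.
    by apply/eqP; rewrite -subr_eq0 opprB addrA; apply/eqP.
  have -> : psi y *m (psi y)^T = P y *m H + H *m P y - 2 *: (P y *m (H *m P y)).
    by apply/esym/eqP; rewrite -subr_eq0; apply/eqP.
  rewrite /L; mx_ring.
(* The entries of P are at most 1 + [mC] in absolute value, those of H at most h. *)
pose B := 2 * ((1 + mC) * h) + h.
have LB y i j : `|L y i j| <= B.
  have -> : L y i j = 2 * (P y i j * eta j) - H i j.
    have PH : (P y *m H) i j = P y i j * eta j.
      by rewrite /H mul_mx_diag [LHS]mxE [X in _ * X]mxE.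
    by rewrite -PH /L; move: (P y *m H) => X; rewrite !mxE.
  apply: le_trans (ler_normB _ _) _; apply: lerD.
    rewrite normrM ger0_norm// ler_wpM2l// normrM ler_pM//.
      rewrite !mxE; apply: le_trans (ler_normB _ _) _; apply: lerD.
        by case: eqP => _; rewrite ?normr1 ?normr0.
      by apply: le_trans (G_le _ _ _) (m_le _).
    by rewrite gtr0_norm; case/andP: (dh j).
  rewrite !mxE; case: eqP => [->|_]; rewrite ?mulr1n ?mulr0n ?normr0//.
  by rewrite gtr0_norm; case/andP: (dh j).
apply: (gronwall_eq0 (C := 2 * N%:R * B) (x0 := x0) (is_derive_sqnorm dD)).
- by move=> y; exact: sqnorm_ge0.
- move=> y; move: (psi y - _) => w.
  have -> : 2 * N%:R * B * sqnorm w =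
     B * (\sum_i \sum_(j < N) w i 0 ^+ 2) + B * (\sum_(i < N) \sum_j w j 0 ^+ 2).
    by rewrite sum_sqr_row sum_sqr_col; ring.
  rewrite -mulrDr -big_split/= mulr_sumr.
  apply: le_trans (ler_norm_sum _ _ _) _; apply: ler_sum => i _.
  rewrite big_ord1 mxE mulr_sumr -big_split/= mulr_sumr.
  apply: le_trans (ler_norm_sum _ _ _) _; apply: ler_sum => j _.
  have -> : 2 * w i 0 * (L y i j * w j 0) = L y i j * (2 * (w i 0 * w j 0)) by ring.
  rewrite normrM ler_pM//.
  have := sqr_ge0 (w i 0 - w j 0); have := sqr_ge0 (w i 0 + w j 0).
  by rewrite ler_norml => ? ?; apply/andP; split; nra.
- rewrite (_ : psi x0 - _ = 0).
    by rewrite /sqnorm big1// => i _; rewrite big1// => j _; rewrite mxE expr0n.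
  by rewrite /c [flow x0 *m _]mulmxA flowN mul1mx mulKVmx// subrr.
Qed.

Variable c : 'cV[R]_N.
Hypothesis psi_c : forall x, psi x = P x *m (flow x *m c).
Let v x : 'cV[R]_N := flow x *m c.
Let A x : 'M[R]_N := \matrix_(i, j) (v x i 0 * v x j 0 / (eta i + eta j)).

Lemma flow_entry x i : v x i 0 = expR (eta i * x) * c i 0.
Proof. by rewrite /v mul_diag_mx !mxE. Qed.

(** Differentiating v_i v_j produces the factor eta_i + eta_j, which cancels the denominator. *)
Lemma mderiv_cauchy : mderiv A (fun x => v x *m (v x)^T).
Proof.
move=> x i j; under eq_fun do rewrite mxE.
have dv k : is_derive x (1 : R) (fun y => v y k 0) (eta k * v x k 0).
  have := mderiv_flow_mul c x k 0; rewrite mul_diag_mx [X in is_derive _ _ _ X]mxE.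
  by rewrite [X in X * _]mxE.
have h := is_deriveZ (eta i + eta j)^-1 (is_deriveM (dv i) (dv j)).
rewrite mxE big_ord1 [X in _ * X]mxE.
under eq_fun do rewrite mulrC.
apply: is_derive_eq h _; rewrite /GRing.scale/=.
by field; rewrite gt_eqF// addr_gt0.
Qed.

Lemma expR_xs i : expR (eta i * xs n) @[n --> \oo] --> (0 : R).
Proof.
apply/cvgrPdist_le => e e0; near=> n.
rewrite sub0r normrN ger0_norm ?expR_ge0// -[leRHS]lnK ?posrE// ler_expR.
rewrite mulrC -ler_pdivlMr//; near: n; exact: xs_Ny.
Unshelve. all: by end_near. Qed.

Lemma cauchy_xs : mcvg (fun n => A (xs n)) 0.
Proof.
have v0 k : v (xs n) k 0 @[n --> \oo] --> (0 : R).
  under eq_fun do rewrite flow_entry.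
  by rewrite -(mul0r (c k 0)); apply: cvgM; [exact: expR_xs|exact: cvg_cst].
move=> i j; rewrite mxE; under eq_fun do rewrite mxE.
rewrite -(mul0r (eta i + eta j)^-1); apply: cvgM; last exact: cvg_cst.
by rewrite -(mul0r 0); exact: cvgM.
Qed.

Lemma cauchy_trace_ge0 x : 0 <= \tr (A x).
Proof.
apply: sumr_ge0 => i _; rewrite mxE divr_ge0 ?addr_ge0 ?(ltW (eta_gt0 _))//.
by rewrite -expr2 sqr_ge0.
Qed.

(** The trace thus supplies a nonnegative primitive of |v|^2 for the Gronwall weight of the next
    lemma. *)
Lemma is_derive_cauchy_trace x : is_derive x 1 (fun y => \tr (A y)) (sqnorm (v x)).
Proof.
rewrite /sqnorm; apply: (@is_derive_finsum _ _ _ _ (fun i y => A y i i)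
  (fun i y => \sum_j v y i j ^+ 2)) => i.
by have := mderiv_cauchy x i i; rewrite mxE !big_ord1 [X in _ * X]mxE -expr2.
Qed.

Lemma cauchy_dressing x : (1%:M + A x) *m P x = 1%:M.
Proof.
apply/eqP; rewrite -subr_eq0; apply/eqP/sqnorm_eq0.
have dZ := mderivB (mderivM (mderivD (mderiv_cst 1%:M) mderiv_cauchy) mderiv_dressing) (mderiv_cst 1%:M).
have {}dZ : mderiv (fun y => (1%:M + A y) *m P y - 1%:M)
    (fun y => - (((1%:M + A y) *m P y - 1%:M) *m v y *m (psi y)^T)).
  apply: mderiv_eq dZ _ => y.
  (* As P v = psi and P is symmetric, the derivative of (1 + A) P is v psi^T - (1 + A) psi psi^T,
     that is - Z v psi^T. *)
  have e1 : (v y)^T *m P y = (psi y)^T by rewrite psi_c [in RHS]trmx_mul tr_dressing.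
  have e2 : P y *m v y = psi y by rewrite psi_c.
  have e3 : ((1%:M + A y) *m P y - 1%:M) *m v y = (1%:M + A y) *m psi y - v y.
    by rewrite mulmxBl mul1mx -[X in X - _]mulmxA e2.
  rewrite e3 mulmxBl opprB add0r subr0 -[X in X + _]mulmxA e1.
  by rewrite [X in _ + X]mulmxN [X in _ - X]mulmxA.
(* The derivative of |Z|^2 is a sum over triples (i, j, k) of terms at most |Z|^2 (|v|^2 + s),
   whence the factor N^3. *)
have dk (z : R) : is_derive z 1 (fun y => N%:R ^+ 3 * (\tr (A y) + m y))
    (N%:R ^+ 3 * (sqnorm (v z) + s z)).
  have h := is_deriveZ (N%:R ^+ 3 : R) (is_deriveD (is_derive_cauchy_trace z) (dm z)).
  exact: is_derive_eq h _.
apply: (gronwall_Ny (is_derive_sqnorm dZ) dk _ _ _ xs_Ny).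
- by move=> z; exact: sqnorm_ge0.
- by move=> z; rewrite mulr_ge0 ?exprn_ge0// addr_ge0 ?cauchy_trace_ge0.
- move=> z; set Z := _ - 1%:M; move: Z => Z.
  have -> : N%:R ^+ 3 * (sqnorm (v z) + s z) * sqnorm Z =
     \sum_(i < N) \sum_(j < N) \sum_(k < N) sqnorm Z * (sqnorm (v z) + s z).
    have cst_sum (a : R) : \sum_(i < N) a = N%:R * a.
      by rewrite sumr_const card_ord mulr_natl.
    by rewrite !cst_sum; ring.
  apply: ler_sum => i _; apply: ler_sum => j _.
  have -> : (- (Z *m v z *m (psi z)^T)) i j =
      - \sum_k Z i k * v z k 0 * psi z j 0.
    rewrite mxE; congr (- _); rewrite mxE big_ord1 [X in _ * X]mxE.
    by rewrite [X in X * _]mxE mulr_suml.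
  rewrite mulrN mulr_sumr -sumrN.
  apply: ler_sum => k _.
  have a1 := sqr_le_sqnorm Z i j; have a2 := sqr_le_sqnorm Z i k.
  have a3 := sqr_le_sqnorm (v z) k 0.
  have a4 : psi z j 0 ^+ 2 <= s z.
    by apply: le_trans (sqr_le_sqnorm _ j 0) _; rewrite lerDl sqnorm_ge0.
  have -> : - (2 * Z i j * (Z i k * v z k 0 * psi z j 0)) =
    (Z i j * Z i k) * (- (2 * (v z k 0 * psi z j 0))) by ring.
  apply: le_trans (ler_norm _) _; rewrite normrM ler_pM//.
    move: (Z i j) (Z i k) (sqnorm Z) a1 a2 => p q t a1 a2.
    have := sqr_ge0 (p - q); have := sqr_ge0 (p + q); rewrite ler_norml => ? ?.
    by apply/andP; split; nra.
  rewrite normrN; apply: le_trans (lerD a3 a4).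
  have := sqr_ge0 (v z k 0 - psi z j 0); have := sqr_ge0 (v z k 0 + psi z j 0).
  by rewrite ler_norml => ? ?; apply/andP; split; nra.
- apply: mcvg_sqnorm.
  have := mcvgB (mcvgM (mcvgD (@mcvg_cst _ _ _ 1%:M) cauchy_xs) dressing_xs) (@mcvg_cst _ _ _ 1%:M).
  by rewrite addr0 mulmx1 subrr.
Qed.

End Soliton.

(** * The determinant formula *)

Section CramerFormula.

(** Sylvester's identity, from two triangular factorizations of the same block matrix. *)
Lemma det_1B_mulmx (R : comNzRingType) m n (p : 'M[R]_(m, n)) (u : 'M[R]_(n, m)) :
  \det (1%:M - p *m u) = \det (1%:M - u *m p).
Proof.
have e1 : block_mx 1%:M p u 1%:M =
    block_mx (1%:M - p *m u) p 0 1%:M *m block_mx 1%:M 0 u 1%:M.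
  by rewrite mulmx_block !(mul1mx, mulmx1, mulmx0, mul0mx, add0r, addr0, subrK).
have e2 : block_mx 1%:M p u 1%:M =
    block_mx 1%:M 0 u 1%:M *m block_mx 1%:M p 0 (1%:M - u *m p).
  by rewrite mulmx_block !(mul1mx, mulmx1, mulmx0, mul0mx, add0r, addr0) addrC subrK.
have := congr1 determinant e1; rewrite e2 !det_mulmx !det_ublock !det_lblock.
by rewrite !det1 !mul1r !mulr1.
Qed.

Lemma cauchy_cramer (R : numFieldType) n (eta w : 'I_n -> R) (psi : 'cV[R]_n) b :
  let A := \matrix_(i, j) (w i * w j / (eta i + eta j)) in
  let B := diag_mx (\row_c ((eta b - eta c) / (eta b + eta c))) in
  (forall i, 0 < eta i) -> \det (1%:M + A) != 0 ->
  (1%:M + A) *m psi = \col_i w i ->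
  psi b 0 = w b * \det (1%:M + B *m A) / \det (1%:M + A).
Proof.
move=> A B eta0 detA Apsi.
have pos i j : eta i + eta j != 0 by rewrite gt_eqF// addr_gt0.
pose u : 'rV[R]_n := \row_j (w j / (eta b + eta j)).
pose D : 'M[R]_n := diag_mx (\row_c (eta b + eta c)).
(* Conjugation by D turns 1 + B A into a rank-one perturbation of 1 + A. *)
have DBA : D *m (1%:M + B *m A) = (1%:M + A - (\col_i w i) *m u) *m D.
  rewrite mulmxDr mulmx1 !mulmxBl mulmxDl mul1mx -addrA; congr (_ + _).
  apply/matrixP => i j; rewrite mul_diag_mx [RHS]mxE [X in _ + X]mxE.
  rewrite !mul_mx_diag mul_diag_mx !mxE big_ord1 !mxE.
  by field; rewrite !pos.
have detD : \det D != 0.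
  by rewrite det_diag; apply/prodf_neq0 => i _; rewrite mxE pos.
have -> : \det (1%:M + B *m A) = \det (1%:M + A - (\col_i w i) *m u).
  apply: (mulfI detD); rewrite -det_mulmx DBA det_mulmx; exact: mulrC.
(* With w = (1 + A) psi the perturbed matrix factors as (1 + A)(1 - psi u), so the quotient of
   determinants is 1 - u psi; row b of the system identifies w_b (1 - u psi) with psi_b. *)
rewrite -Apsi -mulmxA -[X in X - _]mulmx1 -mulmxBr det_mulmx det_1B_mulmx det_mx11.
rewrite -mulrA [X in _ = w b * X]mulrC mulKf//.
have := congr1 (fun M : 'cV[R]_n => M b 0) Apsi.
rewrite mulmxDl mul1mx [LHS]mxE [X in X = _ -> _]addrC [RHS]mxE => /(canRL (addKr _)) ->.
rewrite !mxE eqxx mulr1n mulrBr mulr1 addrC; congr (_ - _).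
by rewrite mulr_sumr; apply: eq_bigr => j _; rewrite !mxE; field.
Qed.

End CramerFormula.

(** * Reduction to one unknown per spectral value *)

Section BlockReduction.
Variables (R : numFieldType) (N K : nat) (blk : 'I_N -> 'I_K) (eta E C : 'I_K -> R).
Variables (c : 'I_N -> R) (psi : 'cV[R]_N).
Hypothesis eta_gt0 : forall b, 0 < eta b.
Hypothesis C_neq0 : forall b, C b != 0.
Hypothesis C_sqr : forall b, \sum_(i | blk i == b) c i ^+ 2 = C b ^+ 2.
Let v i := E (blk i) * c i.
Let w b := C b * E b.
Let A := \matrix_(i < N, j < N) (v i * v j / (eta (blk i) + eta (blk j))).
Let AK := \matrix_(b < K, d < K) (w b * w d / (eta b + eta d)).
Hypothesis A_unit : 1%:M + A \in unitmx.
Hypothesis A_psi : (1%:M + A) *m psi = \col_i v i.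

Lemma sum_blocks (F : 'I_K -> R) :
  \sum_j c j ^+ 2 * F (blk j) = \sum_b C b ^+ 2 * F b.
Proof.
rewrite (partition_big blk xpredT)//=; apply: eq_bigr => b _.
by rewrite -C_sqr mulr_suml; apply: eq_bigr => j /eqP ->.
Qed.

Lemma det_AK_neq0 : \det (1%:M + AK) != 0.
Proof.
apply/det0P => -[y y0 yAK].
(* A left null vector of the reduced matrix, spread over each block in proportion to c, is a left
   null vector of the invertible full matrix. *)
pose z : 'rV[R]_N := \row_i (c i / C (blk i) * y 0 (blk i)).
have zA : z *m (1%:M + A) = 0.
  apply/rowP => j; rewrite mulmxDr mulmx1 !mxE.
  have := congr1 (fun M : 'rV[R]_K => M 0 (blk j)) yAK.
  rewrite mulmxDr mulmx1 !mxE => yj.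
  transitivity (c j / C (blk j) *
    (y 0 (blk j) + \sum_b y 0 b * AK b (blk j))); last by rewrite yj mulr0.
  rewrite mulrDr; congr (_ + _).
  transitivity (E (blk j) * c j * \sum_i c i ^+ 2 *
     (E (blk i) / C (blk i) * y 0 (blk i) / (eta (blk i) + eta (blk j)))).
    by rewrite mulr_sumr; apply: eq_bigr => i _; rewrite !mxE /v; ring.
  rewrite (sum_blocks (fun b => E b / C b * y 0 b / (eta b + eta (blk j)))).
  rewrite !mulr_sumr; apply: eq_bigr => b _; rewrite !mxE /w.
  by field; rewrite !C_neq0/= gt_eqF// addr_gt0.
have z0 : z = 0 by rewrite -(mulmxK A_unit z) zA mul0mx.
move/eqP: y0; apply; apply/rowP => b; rewrite [RHS]mxE.
apply/eqP; apply: contraT => yb.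
have := C_sqr b; rewrite big1 => [/esym/eqP|i /eqP bi].
  by rewrite sqrf_eq0 (negbTE (C_neq0 b)).
have := congr1 (fun M : 'rV[R]_N => M 0 i) z0; rewrite !mxE bi => /eqP.
by rewrite !mulf_eq0 (negbTE yb) invr_eq0 (negbTE (C_neq0 b)) !orbF => /eqP ->; rewrite expr0n.
Qed.

Lemma block_reduction i : let b := blk i in
  psi i 0 = c i / C b * (w b * \det (1%:M +
    diag_mx (\row_d ((eta b - eta d) / (eta b + eta d))) *m AK) / \det (1%:M + AK)).
Proof.
move=> b.
(* Row i of the system reads psi_i = v_i f(b), with a factor f that depends on i only through its
   block b. *)
pose f d := 1 - \sum_j v j * psi j 0 / (eta d + eta (blk j)).
have psif j : psi j 0 = v j * f (blk j).
  have := congr1 (fun M : 'cV[R]_N => M j 0) A_psi.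
  rewrite mulmxDl mul1mx !mxE => /(canRL (addrK _)) ->.
  rewrite /f mulrBr mulr1 mulr_sumr; congr (_ - _).
  by apply: eq_bigr => l _; rewrite !mxE; ring.
have fE d : f d = 1 - \sum_e C e ^+ 2 * (E e ^+ 2 * f e / (eta d + eta e)).
  rewrite /f; congr (1 - _); rewrite -/f.
  rewrite -(sum_blocks (fun e => E e ^+ 2 * f e / (eta d + eta e))).
  by apply: eq_bigr => j _; rewrite psif /v; ring.
(* The vector w f solves the reduced system, because summing c_j^2 over a block yields C^2. *)
have := @cauchy_cramer R K eta w (\col_d (w d * f d)) b eta_gt0 det_AK_neq0.
rewrite -/AK => <-; last first.
  apply/colP => d; rewrite mulmxDl mul1mx !mxE [X in w d * X + _]fE mulrBr mulr1.
  rewrite mulr_sumr -[RHS]addr0 -addrA; congr (_ + _); apply/eqP.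
  rewrite addrC subr_eq0; apply/eqP; apply: eq_bigr => e _; rewrite !mxE /w; ring.
by rewrite mxE psif /v -/b /w; field; exact: C_neq0.
Qed.

End BlockReduction.

(** * Partition of the indices into blocks *)

Section Blocks.
Variables (K : nat) (k : 'I_K -> nat).

Lemma block_end (a : 'I_K) :
  (block_start k a + k a)%N = (\sum_(b < K | (b <= a)%N) k b)%N.
Proof.
rewrite [RHS](bigD1 a)//= addnC; congr (_ + _)%N.
by apply: eq_bigl => b; rewrite andbC ltn_neqAle.
Qed.

Lemma block_lt (a b : 'I_K) : (a < b)%N -> (block_start k a + k a <= block_start k b)%N.
Proof.
move=> ab; rewrite block_end /block_start big_mkcond [X in (_ <= X)%N]big_mkcond.
by apply: leq_sum => c _; have [ca|//] := leqP c a; rewrite (leq_ltn_trans ca ab).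
Qed.

Lemma in_block_uniq (a b : 'I_K) i : in_block k a i -> in_block k b i -> a = b.
Proof.
move=> /andP[a1 a2] /andP[b1 b2]; apply: val_inj => /=.
case: (ltngtP a b) => // /block_lt h.
  by have := leq_trans a2 (leq_trans h b1); rewrite ltnn.
by have := leq_trans b2 (leq_trans h a1); rewrite ltnn.
Qed.

Lemma in_block_ex i : (i < \sum_(a < K) k a)%N -> exists a, in_block k a i.
Proof.
move=> iS; have K0 : (0 < K)%N.
  case: (posnP K) => // K0; move: iS; rewrite big1// => -[b bK].
  by exfalso; move: bK; rewrite K0.
have s0 : (block_start k (Ordinal K0) <= i)%N by rewrite /block_start big1.
(* The last block starting at or before i contains i: past its end, either the next block would
   already have started or i would exceed the total. *)
case: (@arg_maxnP _ (Ordinal K0) (fun b => (block_start k b <= i)%N)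
  (fun b => b : nat) s0) => b bi bmax.
exists b; rewrite /in_block bi /= ltnNge block_end; apply/negP => ib.
have [bK|Kb] := ltnP b.+1 K.
  by have := bmax (Ordinal bK) ib; rewrite /= ltnn.
move: iS; rewrite ltnNge; apply/negP/negPn; apply: leq_trans ib.
rewrite [leqRHS]big_mkcond; apply: leq_sum => c _.
by rewrite ifT// -ltnS (leq_trans (ltn_ord c)).
Qed.

End Blocks.

(** * Decaying solutions and conclusion *)

Section DecayingSolutions.
Variables (R : realType) (N : nat) (eta : 'I_N -> R) (psi psid : R -> 'cV[R]_N).
Implicit Types x : R.
Let H : 'M[R]_N := diag_mx (\row_j eta j).

(** The bounded primitive F yields everything the dressing argument asks for: shifted by its infimum
    it is the function m, and its derivative is small along a sequence. Invertibility of 1 + A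
    follows from its inverse P. *)
Lemma decaying_solution_cauchy (F : R -> R) (C : R) :
  (forall i, 0 < eta i) -> mderiv psi psid ->
  mderiv psid (fun x =>
    H *m (H *m psi x) - 4 *: (psi x *m ((psi x)^T *m (H *m psi x)))) ->
  (forall x, is_derive x 1 F (sqnorm (psi x) + sqnorm (psid x))) ->
  (forall x, `|F x| <= C) ->
  exists c : 'I_N -> R, forall x,
    let v i := expR (eta i * x) * c i in
    let A := \matrix_(i < N, j < N) (v i * v j / (eta i + eta j)) in
    1%:M + A \in unitmx /\ (1%:M + A) *m psi x = \col_i v i.
Proof.
move=> eta0 d1 d2 dF FC.
have s0 x : 0 <= sqnorm (psi x) + sqnorm (psid x) by rewrite addr_ge0 ?sqnorm_ge0.
have FC1 x : - C <= F x by have := FC x; rewrite ler_norml => /andP[].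
have [b [dm bF mN]] := primitive_Ny dF s0 FC1.
have [xs [xsN sxs]] := small_derivative_seq dF FC s0.
have m0 x : 0 <= F x - b by rewrite subr_ge0.
have mC x : F x - b <= C - b by rewrite lerB// (le_trans (ler_norm _)).
have mN' e : 0 < e -> exists X, forall x, x <= X -> F x - b < e.
  by move=> /mN[X hX]; exists X => x /hX; rewrite ltrBlDl.
have [G [dG Gm Gtr]] := dressing_exists d1 dm m0 mN'.
have [c hc] := dressing_flow eta0 d1 d2 dm m0 mC mN' xsN sxs dG Gm Gtr.
have AP := cauchy_dressing eta0 dm m0 mN' xsN dG Gm Gtr hc.
exists (fun i => c i 0) => x v A.
have vE : diag_mx (\row_j expR (eta j * x)) *m c = \col_i v i.
  by apply/colP => i; rewrite mul_diag_mx !mxE.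
have := AP x; rewrite (_ : \matrix_(i, j) _ = A); last first.
  by apply/matrixP => i j; rewrite [LHS]mxE [RHS]mxE !mul_diag_mx !mxE.
move=> AP1; have [Au _] := mulmx1_unit AP1.
by split => //; rewrite hc vE mulmxA AP1 mul1mx.
Qed.

End DecayingSolutions.

(** The parameters a_b = sqrt(2 eta_b) C_b absorb the square roots in M and leave the plain Cauchy
    matrix of w_b = C_b e^{eta_b x}. *)
Lemma Mmx_cauchy (R : realType) (K : nat) (mu C : 'I_K -> R) (x : R) :
  (forall b, 0 < Defs.eta mu b) ->
  Mmx mu (fun b => Num.sqrt (2 * Defs.eta mu b) * C b) x =
  \matrix_(b, d) (C b * expR (Defs.eta mu b * x) * (C d * expR (Defs.eta mu d * x)) /
    (Defs.eta mu b + Defs.eta mu d)).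
Proof.
move=> eta0; apply/matrixP => b d; rewrite !mxE.
have e2 b' : 0 <= 2 * Defs.eta mu b' by rewrite mulr_ge0 ?ltW.
have sq : Num.sqrt (2 * Defs.eta mu b) * Num.sqrt (2 * Defs.eta mu d) =
    2 * Num.sqrt (Defs.eta mu b * Defs.eta mu d).
  rewrite -sqrtrM// (_ : 2 * _ * (2 * _) = 2 ^+ 2 * (Defs.eta mu b * Defs.eta mu d)); last by ring.
  by rewrite sqrtrM ?sqr_ge0// sqrtr_sqr ger0_norm.
have s0 : Num.sqrt (Defs.eta mu b * Defs.eta mu d) != 0.
  by rewrite sqrtr_eq0 -ltNge mulr_gt0.
rewrite mulrACA sq (mulrDl (Defs.eta mu b)) expRD.
by field; rewrite s0/= gt_eqF// addr_gt0.
Qed.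

Theorem theorem1p3 (R : realType) (N K : nat) (mu : 'I_K -> R)
    (k : 'I_K -> nat) (nu : 'I_N -> R) (u : 'I_N -> R -> R)
    (hN : (2 <= N)%N)
    (mu_incr : forall a b : 'I_K, (a < b)%N -> mu a < mu b)
    (mu_lt0 : forall a : 'I_K, mu a < 0)
    (k_ge1 : forall a : 'I_K, (1 <= k a)%N)
    (k_sum : (\sum_(a < K) k a)%N = N)
    (nu_def : forall (a : 'I_K) (i : 'I_N), in_block k a i -> nu i = mu a)
    (u_H1 : forall i : 'I_N, H1 (u i))
    (u_sol : distributional_solution nu u)
    (u_full : forall a : 'I_K,
       ~ {ae (@lebesgue_measure R),
            forall x, \sum_(i < N | in_block k a i) u i x ^+ 2 = 0}) :
  exists2 U : 'I_N -> R -> R, Mmulti mu k U &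
    forall i : 'I_N, {ae (@lebesgue_measure R), forall x, u i x = U i x}.
Proof.
have blk_ex (i : 'I_N) : exists b, in_block k b i.
  by apply: in_block_ex; rewrite k_sum.
have /choice[blk hblk] := blk_ex.
have blkE b (i : 'I_N) : in_block k b i = (blk i == b).
  apply/idP/eqP => [bi|<-]; last exact: hblk.
  exact: in_block_uniq (hblk i) bi.
have eta0 b : 0 < Defs.eta mu b by rewrite sqrtr_gt0 oppr_gt0.
have etaE b : Defs.eta mu b ^+ 2 = - mu b by rewrite sqr_sqrtr// oppr_ge0 ltW.
have nuE i : nu i = - Defs.eta mu (blk i) ^+ 2 by rewrite etaE opprK; exact: nu_def (hblk i).
have [U [G [uU dU dG energy]]] := distributional_solution_regular u_H1 u_sol.
(* Dividing by sqrt(2 eta_i) gives sum U_l^2 = 2 psi^T H psi, so the cubic term takes the matrix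
   form required of psi. *)
pose q i := Num.sqrt (2 * Defs.eta mu (blk i)).
have q2 i : q i ^+ 2 = 2 * Defs.eta mu (blk i) by rewrite sqr_sqrtr// mulr_ge0// ltW.
have q0 i : q i != 0 by rewrite sqrtr_eq0 -ltNge mulr_gt0.
pose psi x : 'cV[R]_N := \col_i ((q i)^-1 * U i x).
pose psid x : 'cV[R]_N := \col_i ((q i)^-1 * G i x).
have dpsi : mderiv psi psid.
  move=> x i j; under eq_fun do rewrite mxE; rewrite mxE.
  exact: is_deriveZ _ (dU i x).
pose etaN i := Defs.eta mu (blk i).
pose H : 'M[R]_N := diag_mx (\row_j etaN j).
have dpsid : mderiv psid (fun x =>
    H *m (H *m psi x) - 4 *: (psi x *m ((psi x)^T *m (H *m psi x)))).
  move=> x i j; under eq_fun do rewrite mxE.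
  apply: is_derive_eq (is_deriveZ (q i)^-1 (dG i x)) _.
  have HE (w : 'cV[R]_N) l j' : (H *m w) l j' = etaN l * w l j' by rewrite mul_diag_mx !mxE.
  have hX : ((psi x)^T *m (H *m psi x)) 0 j = 2^-1 * \sum_l U l x ^+ 2.
    rewrite mxE mulr_sumr; apply: eq_bigr => l _; rewrite HE !mxE.
    have -> : etaN l = q l ^+ 2 / 2 by rewrite q2 /etaN; field.
    by field; exact: q0.
  have hR : (4 *: (psi x *m ((psi x)^T *m (H *m psi x)))) i j =
      4 * (psi x i 0 * (2^-1 * \sum_l U l x ^+ 2)).
    by rewrite -hX mxE; congr (4 * _); rewrite mxE big_ord1.
  rewrite [RHS]mxE HE HE [X in _ = _ + X]mxE hR !mxE nuE /GRing.scale/= /etaN.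
  by field; exact: q0.
have /choice[FC hFC] (i : 'I_N) : exists FC : (R -> R) * R,
    (forall x : R, is_derive x 1 FC.1 (U i x ^+ 2 + G i x ^+ 2)) /\
    forall x, `|FC.1 x| <= FC.2.
  by have [F [C h]] := energy i; exists (F, C).
pose F i := (FC i).1; pose C i := (FC i).2.
pose E x := \sum_i ((q i)^-1 ^+ 2) * F i x.
have dE (x : R) : is_derive x 1 E (sqnorm (psi x) + sqnorm (psid x)).
  rewrite /sqnorm -big_split/=.
  have := @is_derive_finsum R _ (index_enum 'I_N) xpredT
    (fun i y => ((q i)^-1 ^+ 2) * F i y)
    (fun i y => ((q i)^-1 ^+ 2) * (U i y ^+ 2 + G i y ^+ 2)) x.
  move=> h; apply: is_derive_eq (h _) _ => [i|].
    exact: is_deriveZ _ ((hFC i).1 x).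
  by apply: eq_bigr => i _; rewrite !big_ord1 !mxE; ring.
have EC x : `|E x| <= \sum_i ((q i)^-1 ^+ 2) * C i.
  apply: le_trans (ler_norm_sum _ _ _) _; apply: ler_sum => i _.
  by rewrite normrM ger0_norm ?sqr_ge0// ler_wpM2l ?sqr_ge0//; exact: (hFC i).2.
have etaN0 i : 0 < etaN i by exact: eta0.
have [c hc] := decaying_solution_cauchy etaN0 dpsi dpsid dE EC.
pose S b := \sum_(i | blk i == b) c i ^+ 2.
have S0 b : 0 <= S b by apply: sumr_ge0 => i _; exact: sqr_ge0.
(* If c vanished on a block, the rows of that block in (1 + A) psi = v would read psi_i = 0, against
   the assumption that the block of u is not trivial. *)
have Sn0 b : S b != 0.
  apply/eqP => Sb0; apply: (u_full b).
  have c0 i : blk i == b -> c i = 0.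
    move=> bi; apply/eqP; rewrite -sqrf_eq0; apply/eqP.
    by apply: (psumr_eq0P _ Sb0) => // l _; exact: sqr_ge0.
  have U0 i x : blk i == b -> U i x = 0.
    move=> bi; have [_ h] := hc x.
    have := congr1 (fun M : 'cV[R]_N => M i 0) h.
    rewrite mulmxDl mul1mx [LHS]mxE [RHS]mxE (c0 i bi) mulr0.
    rewrite [X in _ + X]mxE big1 ?addr0 => [|l _]; last first.
      by rewrite mxE (c0 i bi) mulr0 !mul0r.
    by rewrite mxE => /eqP; rewrite mulf_eq0 invr_eq0 (negbTE (q0 i))/= => /eqP.
  have FF := ae_filter_ringOfSetsType (@lebesgue_measure R).
  have := ae_forall_ord uU; apply: filterS => x ux.
  by apply: big1 => i; rewrite blkE => bi; rewrite ux U0// expr0n.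
pose D b := Num.sqrt (S b).
have D2 b : D b ^+ 2 = S b by rewrite sqr_sqrtr.
have D0 b : D b != 0 by rewrite -sqrf_eq0 D2.
(* The factor sqrt(2 eta_b) undoes the normalisation of psi; D_b is the Euclidean length of c on the
   block, so c / D is a unit vector there. *)
exists U => //; exists (fun b => Num.sqrt (2 * Defs.eta mu b) * D b), (fun b i => c i / D b).
split.
- by move=> b; rewrite mulf_neq0// sqrtr_eq0 -ltNge mulr_gt0.
- move=> b; under eq_bigl do rewrite blkE.
  under eq_bigr do rewrite exprMn exprVn.
  by rewrite -mulr_suml D2 -/(S b) divff.
- move=> b i; rewrite blkE => /eqP <- x.
  have [Au Apsi] := hc x.
  have := @block_reduction R N K blk (Defs.eta mu) (fun b => expR (Defs.eta mu b * x)) D c (psi x)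
    eta0 D0 (fun b => esym (D2 b)) Au Apsi i.
  rewrite /= mxE => /(canRL (mulVKf (q0 i))) ->.
  rewrite /Vfun Mmx_cauchy// /Bmx /q; ring.
Qed.
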